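(* Let $g \ge 1$ be an integer. (i) Every cone of dimension at most $9$ in the perfect cone decomposition of the rational closure of the cone of positive definite real symmetric $g\times g$ matrices is basic, i.e. its integral generators can be completed to a $\mathbb{Z}$-basis of $\operatorname{Sym}^2(\mathbb{Z}^g)$. (ii) With the exception of the cone of the root lattice $\mathsf{D}_4$ (that is, of the cones $\operatorname{GL}_g(\mathbb{Z})$-equivalent to it, which occur for $g\ge 4$), every cone of dimension at most $10$ in this perfect cone decomposition is simplicial, i.e. its integral generators can be completed to a $\mathbb{Q}$-basis of $\operatorname{Sym}^2(\mathbb{Q}^g)$.
   Context: $\operatorname{Sym}^2(\mathbb{Z}^g)$ (resp. $\operatorname{Sym}^2(\mathbb{Q}^g)$, $\operatorname{Sym}^2(\mathbb{R}^g)$) denotes the symmetric $g\times g$ matrices with entries in $\mathbb{Z}$ (resp. $\mathbb{Q}$, $\mathbb{R}$). The rational closure of the cone of positive definite matrices is the set of positive semidefinite real symmetric matrices whose kernel is spanned by rational vectors. For $v\in\mathbb{Z}^g$ put $p(v)=vv^t$. Perfect cone (first Voronoi) decomposition: for a positive definite $Q\in\operatorname{Sym}^2(\mathbb{R}^g)$, let $\operatorname{Min}(Q)=\{\pm v_1,\dots,\pm v_M\}\subset\mathbb{Z}^g\setminus\{0\}$ be the finite set of nonzero integral vectors at which $v\mapsto v^tQv$ attains its minimum on $\mathbb{Z}^g\setminus\{0\}$, and set $\sigma(Q)=\sum_{i=1}^M\mathbb{R}_{\ge 0}\,p(v_i)$. The perfect cone decomposition for $g$ consists of all cones $\sigma(Q)$,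 $Q$ positive definite, together with $\{0\}$. It is closed under taking faces and is invariant under the action $X\mapsto UXU^t$ of $U\in\operatorname{GL}_g(\mathbb{Z})$; two cones in the same orbit are called $\operatorname{GL}_g(\mathbb{Z})$-equivalent. The dimension of a cone is the dimension of its linear hull. The integral generators of a cone are the generators of its $1$-dimensional faces, normalized to be integral symmetric matrices whose entries have greatest common divisor $1$; for $\sigma(Q)$ these are $p(v_1),\dots,p(v_M)$. A cone is basic if its integral generators can be completed to a $\mathbb{Z}$-basis of $\operatorname{Sym}^2(\mathbb{Z}^g)$, and simplicial if its integral generators are linearly independent (equivalently, can be completed to a $\mathbb{Q}$-basis of $\operatorname{Sym}^2(\mathbb{Q}^g)$). Cone of $\mathsf{D}_4$: let $\mathsf{D}_4=\{x\in\mathbb{Z}^4: x_1+x_2+x_3+x_4 \text{ even}\}$ with the standard Euclidean inner product; fix a lattice basis of $\mathsf{D}_4$ and let $\pm u_1,\dots,\pm u_{12}\in\mathbb{Z}^4$ be the coordinate vectors of its $24$ minimal vectors in this basis. For $g\ge4$, regard $u_i\in\mathbb{Z}^4\subset\mathbb{Z}^g$ by appending zeros. The cone of $\mathsf{D}_4$ is $\sum_{i=1}^{12}\mathbb{R}_{\ge0}\,p(u_i)$, well defined up to $\operatorname{GL}_g(\mathbb{Z})$-equivalence. *)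

(* Defs.v *)
From HB Require Import structures.
From mathcomp Require Import all_boot all_order all_algebra.
From mathcomp Require Import boolp classical_sets reals.
From mathcomp Require Import lra zify.

Set Implicit Arguments.
Unset Strict Implicit.
Unset Printing Implicit Defensive.

Import Order.TTheory GRing.Theory Num.Theory.
Local Open Scope classical_set_scope.
Local Open Scope ring_scope.

Definition symmetric_mx (K : nzRingType) (g : nat) (X : 'M[K]_g) : Prop :=
  X^T = X.

(* B is a basis of the free K-module Sym^2(K^g).  Uniqueness of coordinates
   also makes the entries of B pairwise distinct. *)
Definition sym_basis (K : nzRingType) (g : nat) (B : seq 'M[K]_g) : Prop :=
  (forall X, X \in B -> symmetric_mx X) /\
  (forall X : 'M[K]_g, symmetric_mx X ->
     exists! c : 'rV[K]_(size B), X = \sum_(i < size B) c 0 i *: B`_i).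

Definition rank1 (K : nzRingType) (g : nat) (v : 'cV[K]_g) : 'M[K]_g :=
  v *m v^T.

Definition qform (K : nzRingType) (g : nat) (Q : 'M[K]_g) (v : 'cV[K]_g) : K :=
  (v^T *m Q *m v) 0 0.

Definition minimal_vectors (d : Order.disp_t) (T : porderType d) (n : nat)
    (L : set 'cV[int]_n) (q : 'cV[int]_n -> T) : set 'cV[int]_n :=
  [set v | [/\ L v, v != 0 &
            forall w, L w -> w != 0 -> (q v <= q w)%O]].

Section Cones.
Variable R : realType.

Section Hulls.
Variables m n : nat.
Implicit Types (S C F : set 'M[R]_(m, n)) (U : {vspace 'M[R]_(m, n)}).

Definition cone_hull S : set 'M[R]_(m, n) :=
  [set X | exists (k : nat) (c : 'I_k -> R) (Y : 'I_k -> 'M[R]_(m, n)),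
     [/\ forall i, 0 <= c i, forall i, S (Y i) &
         X = \sum_(i < k) c i *: Y i]].

Definition is_linear_hull S U : Prop :=
  (forall X, S X -> X \in U) /\
  (forall V : {vspace 'M[R]_(m, n)},
     (forall X, S X -> X \in V) -> (U <= V)%VS).

Definition linear_hull S : {vspace 'M[R]_(m, n)} :=
  xget 0%VS [set U | is_linear_hull S U].

Lemma linear_hullP S : is_linear_hull S (linear_hull S).
Proof.
apply: (@xgetPex _ _ [set U | is_linear_hull S U]) => /=.
pose P k := `[< exists s : seq 'M[R]_(m, n),
                 (forall X, X \in s -> S X) /\ \dim <<s>>%VS = k >].
have exP : exists k, P k by exists 0%N; apply/asboolP; exists [::]; rewrite span_nil dimv0.
have bP k : P k -> (k <= \dim {:'M[R]_(m, n)})%N.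
  by move=> /asboolP[s [_ <-]]; apply/dimvS/subvf.
case: (ex_maxnP exP bP) => k /asboolP[s [sS dims]] kmax.
exists <<s>>%VS; split => [X SX|V SV]; last by apply/span_subvP => X /sS/SV.
have sub : (<<s>> <= <<X :: s>>)%VS.
  by apply/span_subvP => Y Ys; rewrite memv_span// inE Ys orbT.
suff -> : <<s>>%VS = <<X :: s>>%VS by rewrite memv_span// mem_head.
apply/eqP; rewrite eqEdim sub /= dims; apply: kmax; apply/asboolP.
by exists (X :: s); split=> // Y; rewrite inE => /predU1P[->//|/sS].
Qed.

Definition cone_dim C : nat := \dim (linear_hull C).

(* Intersection with a supporting hyperplane; l = 0 gives C itself. *)
Definition is_face F C : Prop :=
  exists l : {scalar 'M[R]_(m, n)},
    (forall X, C X -> 0 <= l X) /\ F = [set X | C X /\ l X = 0].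

End Hulls.

Variable g : nat.
Implicit Types (C : set 'M[R]_g) (Q : 'M[R]_g).

Definition positive_definite Q : Prop :=
  symmetric_mx Q /\ forall x : 'cV[R]_g, x != 0 -> 0 < qform Q x.

Definition realify (m n : nat) (X : 'M[int]_(m, n)) : 'M[R]_(m, n) :=
  map_mx (fun z : int => z%:~R) X.

Definition Min Q : set 'cV[int]_g :=
  minimal_vectors setT (fun v => qform Q (realify v)).

Definition sigma Q : set 'M[R]_g :=
  cone_hull [set realify (rank1 v) | v in Min Q].

Definition perfect_cone C : Prop :=
  (exists Q, positive_definite Q /\ C = sigma Q) \/ C = [set 0].

Definition integral_generator C (X : 'M[int]_g) : Prop :=
  [/\ symmetric_mx X,
      \big[gcdn/0%N]_(i < g) \big[gcdn/0%N]_(j < g) `|X i j|%N = 1%N &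
      exists F, [/\ is_face F C, cone_dim F = 1%N &
                    F = cone_hull [set realify X]]].

Definition basic C : Prop :=
  exists B : seq 'M[int]_g,
    sym_basis B /\ forall X, integral_generator C X -> X \in B.

Definition simplicial C : Prop :=
  exists B : seq 'M[rat]_g,
    sym_basis B /\
    forall X, integral_generator C X ->
      map_mx (fun z : int => z%:~R : rat) X \in B.

Definition GLZ_equivalent C C' : Prop :=
  exists U : 'M[int]_g, U \in unitmx /\
    C' = [set realify U *m X *m (realify U)^T | X in C].

End Cones.

Definition D4 : set 'cV[int]_4 :=
  [set x | (2 %| \sum_(i < 4) x i 0)%Z].

(* The columns are the simple roots e1 - e2, e2 - e3, e3 - e4, e3 + e4. *)
Definition D4_basis : 'M[int]_4 :=
  \matrix_(i < 4, j < 4)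
    nth 0 (nth [::] [:: [::  1;  0;  0;  0];
                        [:: -1;  1;  0;  0];
                        [::  0; -1;  1;  1];
                        [::  0;  0; -1;  1]] i) j.

Lemma D4_basisP (x : 'cV[int]_4) :
  D4 x <-> exists! u : 'cV[int]_4, x = D4_basis *m u.
Proof.
have coords (u : 'cV[int]_4) : D4_basis *m u = \col_(i < 4)
    [:: u 0 0; u 1 0 - u 0 0; u 2%:R 0 + u 3%:R 0 - u 1 0;
        u 3%:R 0 - u 2%:R 0]`_i.
  apply/colP => i; rewrite !mxE !big_ord_recl big_ord0 !mxE /=.
  have -> : lift ord0 ord0 = 1 :> 'I_4 by apply/val_inj.
  have -> : lift ord0 (lift ord0 ord0) = 2%:R :> 'I_4 by apply/val_inj.
  have -> : lift ord0 (lift ord0 (lift ord0 ord0)) = 3%:R :> 'I_4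
    by apply/val_inj.
  by case: i => [[|[|[|[|//]]]] ?] /=;
    rewrite ?(mul0r, mul1r, mulN1r, add0r, addr0) // addrC.
have sumE (y : 'cV[int]_4) :
    \sum_(i < 4) y i 0 = y 0 0 + y 1 0 + y 2%:R 0 + y 3%:R 0.
  rewrite !big_ord_recl big_ord0 addr0 !addrA.
  by congr (y _ _ + y _ _ + y _ _ + y _ _); apply/val_inj.
have ext (y z : 'cV[int]_4) : y 0 0 = z 0 0 -> y 1 0 = z 1 0 ->
    y 2%:R 0 = z 2%:R 0 -> y 3%:R 0 = z 3%:R 0 -> y = z.
  move=> e0 e1 e2 e3; apply/colP => -[[|[|[|[|//]]]] Hi].
  - by have -> : Ordinal Hi = 0 by apply/val_inj.
  - by have -> : Ordinal Hi = 1 by apply/val_inj.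
  - by have -> : Ordinal Hi = 2%:R by apply/val_inj.
  - by have -> : Ordinal Hi = 3%:R by apply/val_inj.
rewrite /D4 /= sumE; split=> [/dvdzP[k kE]|[u [-> _]]]; last first.
  rewrite coords !mxE /=; apply/dvdzP; exists (u 3%:R 0); lia.
exists (\col_(i < 4) [:: x 0 0; x 0 0 + x 1 0; k - x 3%:R 0; k]`_i).
split=> [|v xv].
  by rewrite coords; apply: ext; rewrite !mxE /=; lia.
move: kE; rewrite xv coords !mxE /= => kE.
by apply: ext; rewrite !mxE /=; lia.
Qed.

(* Coordinate vectors of the minimal vectors of D4; pid_mx 4 appends zeros
   when 4 <= g. *)
Definition D4_coordinates : set 'cV[int]_4 :=
  [set u | minimal_vectors D4 (qform 1%:M) (D4_basis *m u)].

Definition D4_cone (R : realType) (g : nat) : set 'M[R]_g :=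
  cone_hull [set realify R (rank1 (pid_mx 4 *m u)) | u in D4_coordinates].

(* Main.v *)
Require Import Defs.
From mathcomp Require Import all_boot all_order all_algebra.
From mathcomp Require Import boolp classical_sets reals.
From mathcomp Require Import ring lra zify.

Set Implicit Arguments.
Unset Strict Implicit.
Unset Printing Implicit Defensive.

Import Order.TTheory GRing.Theory Num.Theory.
Local Open Scope ring_scope.

(* Let Q be positive definite with minimum m, and write p(v) = v v^t.

   If x = sum t_i v_i is a lattice vector with minimal vectors v_i and t_i >= 0,
   then sum t_i (Q(x - v_i) - m) = (sum t_i - 2) Q(x), so sum t_i >= 2 unless x is
   0 or one of the v_i.  Hence at most four independent minimal vectors e_i have
   only integral combinations in the lattice, except that four of them may have
   their half sum there; the e_i are then orthogonal and generate, with that half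
   sum, a D4 whose vectors p(v) span a space of dimension 10.  Without such a
   quadruple, lattice vectors have coordinates all in Z or all in 1/2 + Z with
   respect to five independent minimal vectors.

   Assume there is no such quadruple.  Minimal vectors in a subspace of dimension
   at most 4 form a unimodular system, for which the p(v) (v up to sign) are
   independent over every field.  A relation sum c_i p(v_i) = 0 modulo a prime
   with N <= 9 nonzero terms has totally isotropic row space, so its vectors have
   rank at most N/2 modulo p, and one reduces to that case.  In a real relation
   with at most 11 terms, the positive or the negative terms number at most 5 and
   span everything; when they form a basis of a space of dimension 5, comparing
   traces for Q and for the form making this basis orthonormal leaves no room for
   the other terms.  Thus the p(v) are independent over R when the cone has
   dimension at most 10, and modulo every prime when it has dimension at most 9. *)

(** By the Smith normal form, a family of integral forms independent modulo every prime extends to a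
    Z-basis. Hence part (i) needs relations over every ['F_p], while part (ii) needs only real ones.

    Unimodular systems are treated by contraction along a vector. The delicate case is
    characteristic 2, where a triangle u, w, u + w may carry equal nonzero coefficients and only
    signs exclude a Fano plane.

    The bounds come from halving: nine terms leave rank at most 4 modulo p, eleven terms leave at
    most five of one sign. Eleven also turns a bound on the dimension into one on the number of
    minimal vectors, since eleven independent forms do not fit in dimension 10. In a relation modulo
    p, a vector dependent on a basis modulo p but not over R produces five minimal vectors whose
    half sum is a lattice vector; then at most five vectors up to sign are left, while a relation of
    rank 4 needs eight.

    The D4 cone is not simplicial because two orthogonal frames of minimal vectors have forms with
    the same sum. *)

Notation "A %:mx k" := (map_mx (intr : int -> k) A)
  (at level 2, k at level 1, format "A %:mx  k").

(** * Saturated integer matrices *)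

Definition zfree n N (A : 'M[int]_(n, N)) : Prop :=
  forall z : 'rV_n, z *m A = 0 -> z = 0.

(* The row lattice of A is saturated in Z^N; this also forces the rows to be
   independent. *)
Definition saturated n N (A : 'M[int]_(n, N)) : Prop :=
  forall (q : int) (y : 'rV_N) (z : 'rV_n),
    q != 0 -> q *: y = z *m A -> exists z', z = q *: z'.

Lemma intr_unitmx (k : fieldType) n (A : 'M[int]_n) :
  A \in unitmx -> A%:mx k \in unitmx.
Proof. by rewrite !unitmxE det_map_mx; apply: rmorph_unit. Qed.

Lemma scalemx_inj (k : idomainType) m n (a : k) :
  a != 0 -> injective (fun X : 'M_(m, n) => a *: X).
Proof.
move=> a0 X Y /matrixP e; apply/matrixP => i j.
by have := e i j; rewrite !mxE => /(mulfI a0).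
Qed.

Lemma unitmx_pid (K : comUnitRingType) n N (L : 'M[K]_n) : (n <= N)%N ->
  L \in unitmx -> exists2 L' : 'M_N, L' \in unitmx & L *m pid_mx n = pid_mx n *m L'.
Proof.
move=> /subnKC; move: (N - n)%N => m <- uL; exists (block_mx L 0 0 1%:M).
  by rewrite unitmxE det_ublock det1 mulr1 -unitmxE.
rewrite pid_mx_row mul_row_block mul_mx_row.
by rewrite !mulmx1 !mul0mx !mulmx0 !mul1mx !addr0.
Qed.

Section Smith.
Variables n N : nat.
Implicit Type A : 'M[int]_(n, N).

(** The Smith form read row by row: after the change of basis [invmx L], each row is [d_i] times a
    row of a unimodular matrix, so freeness and saturation become conditions on single invariants.
    The second alternative covers rows beyond the width of the matrix. *)
Lemma smith_rows A : exists L R (d : seq int),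
  [/\ L \in unitmx, R \in unitmx,
      A = L *m (\matrix_(i, j) (d`_i *+ (i == j :> nat))) *m R &
      forall (i : 'I_n), (exists2 j : 'I_N, j = i :> nat &
             row i (invmx L) *m A = d`_i *: row j R) \/
           ((N <= i)%N /\ row i (invmx L) *m A = 0)].
Proof.
have [L uL [R uR [d _ eA]]] := int_Smith_normal_form A.
exists L, R, d; split=> // i.
set D : 'M_(n, N) := \matrix_(_, _) _ in eA.
have rE : row i (invmx L) *m A = row i D *m R.
  by rewrite {1}eA -!mulmxA -row_mul mulKmx // row_mul.
have [le|lt] := leqP N i.
  right; split=> //; rewrite rE; suff -> : row i D = 0 by rewrite mul0mx.
  apply/rowP => j; rewrite !mxE; case: eqP => // e.
  by move: (ltn_ord j); rewrite -e ltnNge le.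
left; exists (Ordinal lt) => //; rewrite rE [row (Ordinal lt) R]rowE scalemxAl.
congr (_ *m _); apply/rowP => j; rewrite !mxE eqxx /= mulr_natr.
by congr (_ *+ _); rewrite -val_eqE /= eq_sym.
Qed.

(** Rows of a unimodular matrix are primitive. The case [q = 0] says that they are nonzero. *)
Lemma row_invmx_neq0 (L : 'M[int]_n) i (q : int) z :
  L \in unitmx -> row i (invmx L) = q *: z -> q \is a GRing.unit.
Proof.
move=> uL e; have e1 : q * (z *m L) 0 i = 1.
  have := congr1 (fun x => (x *m L) 0 i) e.
  by rewrite -row_mul mulVmx // -scalemxAl [RHS]mxE => <-; rewrite !mxE eqxx.
by apply/unitrP; exists ((z *m L) 0 i); rewrite mulrC.
Qed.

Lemma zfree_row_free (k : numFieldType) A : zfree A -> row_free (A%:mx k).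
Proof.
move=> Af; have [L [R [d [uL uR eA dA]]]] := smith_rows A.
have r0 i : row i (invmx L) *m A <> 0.
  move=> /Af e; have := @row_invmx_neq0 L i 0 0 uL.
  by rewrite scale0r => /(_ e); rewrite unitr0.
have uLk := intr_unitmx k uL; have uRk := intr_unitmx k uR.
apply/inj_row_free => v; rewrite {1}eA !map_mxM !mulmxA => v0.
have := congr1 (mulmx^~ (invmx (R%:mx k))) v0; rewrite mulmxK // mul0mx => {}v0.
rewrite -[v](mulmxK uLk); suff -> : v *m L%:mx k = 0 by rewrite mul0mx.
apply/rowP => i.
rewrite [RHS]mxE.
case: (dA i) => [[j ji e]|[_ /r0//]].
have di : d`_i != 0 by apply/eqP => d0; apply: (r0 i); rewrite e d0 scale0r.
have := congr1 (fun x : 'rV_N => x 0 j) v0; rewrite !mxE (bigD1 i) //= big1 => [|i' ii'].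
  rewrite addr0 !mxE ji eqxx mulr1n => /eqP; rewrite mulf_eq0 intr_eq0 (negPf di) orbF => /eqP.
  by [].
rewrite !mxE ji; have /negPf-> : i' != i :> nat by [].
by rewrite mulr0n mulr0.
Qed.

Lemma saturated_zfree A : saturated A -> zfree A.
Proof.
move=> sA z zA; apply/rowP => i; rewrite mxE; apply/eqP/negPn/negP => zi.
(* With y = 0 and q = 2 z_i, saturation would give z_i = 2 z_i z'_i, that is 1 = 2 z'_i. *)
have [] := sA (z 0 i * 2) 0 z; [by rewrite mulf_neq0|by rewrite scaler0 zA|].
move=> z' /(congr1 (fun x : 'rV_n => x 0 i)); rewrite !mxE => /eqP.
rewrite -[X in X == _]mulr1 -mulrA (inj_eq (mulfI zi)) => /eqP; lia.
Qed.

(** Saturation makes every [d_i] a unit, because [d_i] times the integral vector [row j R] lies in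
    the row lattice; the units are then absorbed into [L]. *)
Lemma saturated_completion A : saturated A ->
  (n <= N)%N /\ exists2 P, P \in unitmx & A = pid_mx n *m P.
Proof.
move=> sA; have [L [R [d [uL uR eA dA]]]] := smith_rows A.
have r0 i : row i (invmx L) *m A <> 0.
  move=> /(saturated_zfree sA) e; have := @row_invmx_neq0 L i 0 0 uL.
  by rewrite scale0r => /(_ e); rewrite unitr0.
have le : (n <= N)%N.
  rewrite leqNgt; apply/negP => lt.
  have [[j /= ji]|[_ /r0//]] := dA (Ordinal lt).
  by move: (ltn_ord j); rewrite ji ltnn.
split=> //.
have du i : (i < n)%N -> d`_i \is a GRing.unit.
  move=> lt; have [[j /= ji e]|[_ /r0//]] := dA (Ordinal lt).
  have [] := sA d`_i (row j R) (row (Ordinal lt) (invmx L)).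
  - by apply/eqP => d0; apply: (r0 (Ordinal lt)); rewrite e d0 scale0r.
  - by rewrite e.
  - by move=> z' /row_invmx_neq0; apply.
pose D := diag_mx (\row_(i < n) d`_i).
have uD : D \in unitmx.
  by rewrite unitmxE det_diag unitr_prod_in // => i _; rewrite mxE du.
have eD : (\matrix_(i, j) (d`_i *+ (i == j :> nat))) = D *m pid_mx n :> 'M_(n, N).
  apply/matrixP => i j; rewrite !mxE (bigD1 i) //= big1 => [|l li].
    by rewrite addr0 !mxE eqxx ltn_ord andbT mulr1n mulr_natr.
  by rewrite !mxE eq_sym (negPf li) mulr0n mul0r.
rewrite eD mulmxA in eA; set L' := L *m D in eA.
have uL' : L' \in unitmx by rewrite unitmx_mul uL.
have [P uP LP] := unitmx_pid le uL'.
exists (P *m R); first by rewrite unitmx_mul uP.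
by rewrite mulmxA -LP.
Qed.

Lemma eq0_modp (p : nat) m (x : 'M[int]_(m, N)) : prime p -> x%:mx 'F_p = 0 ->
  exists y, x = p%:Z *: y.
Proof.
move=> pp x0; exists (\matrix_(i, j) (x i j %/ p%:Z)%Z).
apply/matrixP => i j; rewrite !mxE mulrC divzK //.
have := congr1 (fun z : 'M_(_, _) => z i j) x0; rewrite !mxE => /eqP.
by rewrite (dvdz_pcharf (pchar_Fp pp)).
Qed.

End Smith.

(** Prime factors of [q] are removed one at a time: modulo p the equation reads [z *m A = 0], so
    independence makes z divisible by p. *)
Lemma row_free_saturated n N (A : 'M[int]_(n, N)) :
  (forall p, prime p -> row_free (A%:mx 'F_p)) -> saturated A.
Proof.
move=> Ap q; move: {2}`|q|%N (leqnn `|q|%N) => b; elim: b q => [|b IH] q.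
  by rewrite leqn0 absz_eq0 => /eqP->; rewrite eqxx.
move=> qb y z q0 e; have [q1|q1] := eqVneq `|q|%N 1%N.
  exists (q *: z); rewrite scalerA; suff -> : q * q = 1 by rewrite scale1r.
  lia.
pose p := pdiv `|q|%N.
have pp : prime p by rewrite pdiv_prime // ltn_neqAle eq_sym q1 absz_gt0.
have /dvdzP[q' eq] : (p%:Z %| q)%Z by rewrite dvdzE /= pdiv_dvd.
have [|z' ez] := @eq0_modp n p 1 z pp.
  apply: (row_free_inj (Ap p pp)); rewrite mul0mx -map_mxM -e.
  apply/matrixP => i j; rewrite !mxE eq rmorphM /= rmorphM /=.
  have /eqP : (p%:~R : 'F_p) == 0 by rewrite -(dvdz_pcharf (pchar_Fp pp)).
  by move=> ->; rewrite mulr0 mul0r.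
have p0 : p%:Z != 0 by have := prime_gt0 pp; lia.
have q'0 : q' != 0 by apply: contraNneq q0 => q'0; rewrite eq q'0 mul0r.
have [| |z'' ez'] := IH q' _ y z' q'0.
- have := prime_gt1 pp; move: qb; rewrite eq abszM absz_nat.
  have : (0 < `|q'|)%N by rewrite absz_gt0.
  nia.
- apply: (scalemx_inj p0); rewrite scalerA mulrC -eq e ez scalemxAl //.
by exists z''; rewrite ez ez' scalerA mulrC -eq.
Qed.

(** * Unimodular systems of vectors *)

Lemma saturated_rinv n N (A : 'M[int]_(n, N)) :
  saturated A -> exists B, A *m B = 1%:M.
Proof.
move=> /saturated_completion[le [P uP ->]]; exists (invmx P *m pid_mx n).
by rewrite mulmxA mulmxK // mul_pid_mx minnn (minn_idPr le) pid_mx_1.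
Qed.

Definition eqpm r (x y : 'rV[int]_r) := (x == y) || (x == - y).

Lemma eqpm_equiv r : equivalence_rel (@eqpm r).
Proof.
move=> x y z; split=> [|/orP[]/eqP-> //]; first by rewrite /eqpm eqxx.
by rewrite /eqpm orbC eqr_opp eqr_oppLR.
Qed.

Lemma eqpmC r (x y : 'rV[int]_r) : eqpm x y = eqpm y x.
Proof. by rewrite /eqpm [x == y]eq_sym [x == - y]eq_sym eqr_oppLR. Qed.

Lemma sum_classes0 (k : nzRingType) (I : finType) (e : rel I) (c F : I -> k) :
  equivalence_rel e -> (forall i j, e i j -> F i = F j) ->
  (forall i, F i = 0 \/ \sum_(j | e i j) c j = 0) -> \sum_i c i * F i = 0.
Proof.
move=> eq_e eF c0; have refl i : e i i by case: (eq_e i i i).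
pose rep i := [pick j | e i j].
rewrite (partition_big rep xpredT) //=; apply: big1 => o _.
have [i0 /eqP ri0|no] := pickP [pred i | rep i == o]; last first.
  by rewrite big_pred0 // => i; apply: no.
have repE i : (rep i == o) = e i0 i.
  apply/eqP/idP => [|ei].
    rewrite -ri0 /rep; case: pickP => [j ej|/(_ i)]; last by rewrite refl.
    case: pickP => // j' ej' [ejj']; rewrite ejj' in ej.
    have [_ /(_ ej') ->] := eq_e i0 j' i.
    by have [_ /(_ ej) <-] := eq_e i j' i.
  rewrite -ri0; apply: eq_pick => j.
  by have [_ ->] := eq_e i0 i j.
rewrite (eq_bigl _ _ repE) (eq_bigr (fun i => c i * F i0)) => [|i /eF-> //].
by rewrite -mulr_suml; case: (c0 i0) => ->; rewrite ?mulr0 ?mul0r.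
Qed.

(** * Relations between the rank one forms of a unimodular system *)

Section Unimodular.
Variable k : fieldType.

(* The total coefficient of the vectors equal to w up to sign: allowing repetitions
   makes the induction step by projection along a vector possible. *)
Definition csum r N (V : 'I_N -> 'rV[int]_r) (c : 'I_N -> k) w :=
  \sum_(i | eqpm (V i) w) c i.

Lemma csum_eqpm r N (V : 'I_N -> 'rV[int]_r) c w w' :
  eqpm w w' -> csum V c w = csum V c w'.
Proof.
move=> e; apply: eq_bigl => i; rewrite !(eqpmC (V i)).
by have [_ ->] := @eqpm_equiv r w w' (V i).
Qed.

(** Isolates the class of w: an even test function that vanishes on all other classes of nonzero
    total coefficient reduces a relation to one term. *)
Lemma sum_classes r N (V : 'I_N -> 'rV[int]_r) c (F : 'rV_r -> k) w :
  (forall x, F (- x) = F x) ->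
  (forall i, ~~ eqpm (V i) w -> F (V i) = 0 \/ csum V c (V i) = 0) ->
  \sum_i c i * F (V i) = csum V c w * F w.
Proof.
move=> Fn F0; have Fe x y : eqpm x y -> F x = F y.
  by move=> /orP[]/eqP-> //; rewrite Fn.
rewrite (bigID (fun i => eqpm (V i) w)) /= mulr_suml.
rewrite [X in _ + X](_ : _ = 0) ?addr0.
  by apply: eq_bigr => i /Fe->.
pose G i := if eqpm (V i) w then 0 else F (V i).
rewrite big_mkcond /= -[RHS](@sum_classes0 k _ (fun i j => eqpm (V i) (V j)) c G).
- by apply: eq_bigr => i _; rewrite /G; case: eqpm; rewrite /= ?mulr0.
- by move=> i j l; apply: eqpm_equiv.
- move=> i j e; rewrite /G (Fe _ _ e).
  by have [_ /(_ e) ->] := @eqpm_equiv r (V i) (V j) w.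
- move=> i; rewrite /G; case: ifPn => [_|/F0[|b]]; [by left|by left|right].
  by rewrite -[RHS]b; apply: eq_bigl => j; rewrite eqpmC.
Qed.

Definition ind2 r (a b : 'rV[int]_r) :=
  forall x y : int, x *: a + y *: b = 0 -> x = 0 /\ y = 0.
Definition ind3 r (a b c : 'rV[int]_r) :=
  forall x y z : int, x *: a + y *: b + z *: c = 0 -> [/\ x = 0, y = 0 & z = 0].

Section System.
Variables (r : nat) (S : 'rV[int]_r -> Prop).
Hypothesis SN : forall x, S x -> S (- x).
Hypothesis Ssat : forall n (A : 'M_(n, r)),
  (forall i, S (row i A)) -> zfree A -> saturated A.

Lemma zfree1 (u : 'rV[int]_r) : u != 0 -> zfree u.
Proof.
move=> u0 z; rewrite [z]mx11_scalar mul_scalar_mx => e.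
have [->|z0] := eqVneq (z 0 0) 0; first by rewrite raddf0.
by case/eqP: u0; apply: (scalemx_inj z0); rewrite /= e scaler0.
Qed.

Lemma sat1 u : S u -> u != 0 -> saturated u.
Proof.
move=> Su u0; apply: Ssat; last exact: zfree1.
by move=> i; rewrite row_id.
Qed.

Lemma dvd1 u (q x : int) y : S u -> u != 0 -> q != 0 ->
  q *: y = x *: u -> (q %| x)%Z.
Proof.
move=> Su u0 q0 e; have [z' /(congr1 (fun z : 'rV__ => z 0 0))] :
    exists z', x%:M = q *: z' :> 'rV_1.
  by apply: (sat1 Su u0 (y := y)) => //; rewrite mul_scalar_mx.
by rewrite !mxE mulr1n => ->; rewrite dvdz_mulr.
Qed.

Lemma sat2 a b : S a -> S b -> ind2 a b -> saturated (col_mx a b).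
Proof.
move=> Sa Sb ab; apply: Ssat.
  move=> i.
  have -> : row i (col_mx a b) = if split i is inl _ then a else b.
    apply/rowP => j; rewrite !mxE; case: split => l; by rewrite [l]ord1.
  by case: split.
move=> z; rewrite -[z]hsubmxK mul_row_col [lsubmx z]mx11_scalar [rsubmx z]mx11_scalar.
by rewrite !mul_scalar_mx => /ab[-> ->]; rewrite raddf0 row_mx0.
Qed.

Lemma dvd2 a b (q x z : int) y : S a -> S b -> ind2 a b -> q != 0 ->
  q *: y = x *: a + z *: b -> (q %| x)%Z /\ (q %| z)%Z.
Proof.
move=> Sa Sb ab q0 e; have [w ew] :
    exists w, row_mx x%:M z%:M = q *: w :> 'rV_(1 + 1).
  by apply: (sat2 Sa Sb ab (y := y)) => //; rewrite mul_row_col !mul_scalar_mx.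
have e1 := congr1 (fun z : 'rV_(1 + 1) => lsubmx z 0 0) ew.
have e2 := congr1 (fun z : 'rV_(1 + 1) => rsubmx z 0 0) ew.
rewrite row_mxKl !mxE mulr1n in e1; rewrite row_mxKr !mxE mulr1n in e2.
by rewrite e1 e2 !dvdz_mulr.
Qed.

Lemma dvd3 a b c (q x z t : int) y : S a -> S b -> S c -> ind3 a b c -> q != 0 ->
  q *: y = x *: a + z *: b + t *: c -> [/\ (q %| x)%Z, (q %| z)%Z & (q %| t)%Z].
Proof.
move=> Sa Sb Sc abc q0 e; have [w ew] :
    exists w, row_mx (row_mx x%:M z%:M) t%:M = q *: w :> 'rV_(1 + 1 + 1).
  apply: (@Ssat _ (col_mx (col_mx a b) c) _ _ _ y) => //.
  - move=> i; have -> : row i (col_mx (col_mx a b) c) =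
      match split i with inr _ => c
      | inl j => if split j is inl _ then a else b end.
      apply/rowP => j; rewrite !mxE; case: split => l; last by rewrite [l]ord1.
      by rewrite mxE; case: split => l'; rewrite [l']ord1.
    by case: split => // j; case: split.
  - move=> v; rewrite -[v]hsubmxK -[lsubmx v]hsubmxK !mul_row_col.
    rewrite [lsubmx (lsubmx v)]mx11_scalar [rsubmx (lsubmx v)]mx11_scalar [rsubmx v]mx11_scalar.
    by rewrite !mul_scalar_mx => /abc[-> -> ->]; rewrite raddf0 !row_mx0.
  - by rewrite !mul_row_col !mul_scalar_mx.
have e1 := congr1 (fun z : 'rV_(1 + 1 + 1) => lsubmx (lsubmx z) 0 0) ew.
have e2 := congr1 (fun z : 'rV_(1 + 1 + 1) => rsubmx (lsubmx z) 0 0) ew.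
have e3 := congr1 (fun z : 'rV_(1 + 1 + 1) => rsubmx z 0 0) ew.
rewrite /= !row_mxKl !mxE mulr1n in e1; rewrite row_mxKl row_mxKr !mxE mulr1n in e2.
rewrite row_mxKr !mxE mulr1n in e3.
by rewrite e1 e2 e3 !dvdz_mulr.
Qed.

(** Nonzero members of S are primitive, so two proportional ones differ by a unit factor. *)
Lemma ind2S u w : S u -> S w -> u != 0 -> w != 0 -> ~~ eqpm w u -> ind2 u w.
Proof.
move=> Su Sw u0 w0 nuw x y e.
have [y0|y0] := eqVneq y 0.
  move: e; rewrite y0 scale0r addr0 => xu; split=> //; apply/eqP/negPn/negP => x0.
  by case/eqP: u0; apply: (scalemx_inj x0); rewrite /= xu scaler0.
have ew : y *: w = (- x) *: u by rewrite scaleNr; apply/eqP; rewrite -addr_eq0 addrC e.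
have /dvdzP[t et] := dvd1 Su u0 y0 ew.
have wt : w = t *: u by apply: (scalemx_inj y0); rewrite /= ew et scalerA mulrC.
have t0 : t != 0 by apply: contraNneq w0 => t0; rewrite wt t0 scale0r.
have : (t %| 1)%Z by apply: (dvd1 Sw w0 t0 (y := u)); rewrite scale1r.
rewrite dvdz1 => t1; case/negP: nuw; rewrite /eqpm wt.
have [->|->] : t = 1 \/ t = - 1 by lia.
  by rewrite scale1r eqxx.
by rewrite scaleN1r eqxx orbT.
Qed.

Lemma ind2_neq0 (a b : 'rV[int]_r) : ind2 a b -> a != 0 /\ b != 0.
Proof.
move=> ab; split; apply/eqP => e.
  by have [] := ab 1 0; rewrite ?e ?scaler0 ?scale0r ?addr0.
by have [] := ab 0 1; rewrite ?e ?scaler0 ?scale0r ?addr0.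
Qed.

(** The difference of w + t u and w is divisible by t, while its coefficients on these two are 1 and
    -1. *)
Lemma shift_unit u w (t : int) : S w -> ind2 u w -> S (w + t *: u) ->
  t = 0 \/ t = 1 \/ t = - 1.
Proof.
move=> Sw uw St; have [->|t0] := eqVneq t 0; first by left.
have : ind2 (w + t *: u) w.
  move=> x y; rewrite scalerDr scalerA addrAC -scalerDl addrC => /uw[/eqP].
  by rewrite mulf_eq0 (negPf t0) orbF => /eqP->; rewrite add0r.
move=> /(dvd2 (q := t) (x := 1) (z := -1) (y := u) St Sw)[] //.
  by rewrite scale1r scaleN1r addrAC subrr add0r.
by rewrite dvdz1; lia.
Qed.

(** The sum of w + u and w - u is twice a lattice vector. *)
Lemma shift_excl u w : ind2 u w -> S (w + u) -> S (w - u) -> False.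
Proof.
move=> uw S1 S2; have : ind2 (w + u) (w - u).
  move=> x y e; have := uw (x - y) (x + y); rewrite -[_ + _]/(_ + _) => /(_ _)[].
    rewrite -[RHS]e !scalerDr scalerN !scalerBl !scalerDl; apply/rowP => i.
    by rewrite !mxE; ring.
  lia.
move=> /(dvd2 (q := 2) (x := 1) (z := 1) (y := w) S1 S2)[] //.
by apply/rowP => i; rewrite !mxE; ring.
Qed.

(** A member of S in the plane of u and w, other than these up to sign, has both coefficients equal
    to 1 or -1; beside w + u, the vector w - u is excluded by [shift_excl]. *)
Lemma ind3S u w t : S u -> S w -> S t -> t != 0 -> ind2 u w -> S (w + u) ->
  ~~ eqpm t u -> ~~ eqpm t w -> ~~ eqpm t (w + u) -> ind3 u w t.
Proof.
move=> Su Sw St t0 uw Swu tu tw twu; have [u0 w0] := ind2_neq0 uw.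
have iu := ind2S Su St u0 t0 tu; have iw := ind2S Sw St w0 t0 tw.
move=> x y z e; have [z0|z0] := eqVneq z 0.
  by move: e; rewrite z0 scale0r addr0 => /uw[-> ->].
have [|] := @dvd2 u w z (- x) (- y) t Su Sw uw z0.
  apply/eqP; rewrite -subr_eq0 -[X in _ == X]e.
  by apply/eqP/rowP => i; rewrite !mxE; ring.
rewrite !rpredN => /dvdzP[a ea] /dvdzP[b eb].
have et : t = (- a) *: u + (- b) *: w.
  apply: (scalemx_inj z0); apply/eqP; rewrite -subr_eq0 -[X in _ == X]e ea eb /=.
  by apply/eqP/rowP => i; rewrite !mxE; ring.
have a0 : a != 0.
  apply/eqP => a0; have [|_] := iw b 1; last by [].
  by rewrite et a0; apply/rowP => i; rewrite !mxE; ring.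
have b0 : b != 0.
  apply/eqP => b0; have [|_] := iu a 1; last by [].
  by rewrite et b0; apply/rowP => i; rewrite !mxE; ring.
have [|_ b1] := @dvd2 u t b (- a) (- 1) w Su St iu b0.
  by rewrite et; apply/rowP => i; rewrite !mxE; ring.
have [|_ a1] := @dvd2 w t a (- b) (- 1) u Sw St iw a0.
  by rewrite et; apply/rowP => i; rewrite !mxE; ring.
rewrite !rpredN !dvdz1 in a1 b1.
have {}a1 : a = 1 \/ a = -1 by lia.
have {}b1 : b = 1 \/ b = -1 by lia.
have tE : t = w + u \/ t = - (w + u) \/ t = u - w \/ t = - (u - w).
  rewrite et; case: a1 => ->; case: b1 => ->; rewrite ?opprK ?scaleN1r ?scale1r ?opprD ?opprK.
  - by right; left; rewrite addrC.
  - by do 3 right.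
  - by do 2 right; left.
  - by left; rewrite addrC.
have Swu' : S (w - u) -> False by apply: shift_excl.
case: tE twu Swu' => [->|[->|[e1|e1]]]; rewrite /eqpm ?eqxx ?orbT // => _ [].
  by rewrite -opprB -e1; apply: SN.
by rewrite -opprB -e1.
Qed.

(** If a sign differed, the two vectors would be independent with sum twice a lattice vector. *)
Lemma sign_eq u w t (a1 b1 a2 b2 : int) : ind3 u w t ->
  (a1 = 1 \/ a1 = -1) -> (b1 = 1 \/ b1 = -1) ->
  (a2 = 1 \/ a2 = -1) -> (b2 = 1 \/ b2 = -1) ->
  S (t + a1 *: u + b1 *: w) -> S (t + a2 *: u + b2 *: w) -> a1 = a2 /\ b1 = b2.
Proof.
move=> i3 ha1 hb1 ha2 hb2 S1 S2; apply: contrapT => ne.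
have i2 : ind2 (t + a1 *: u + b1 *: w) (t + a2 *: u + b2 *: w).
  move=> x y e; have [|] := i3 (x * a1 + y * a2) (x * b1 + y * b2) (x + y).
    by rewrite -[RHS]e; apply/rowP => i; rewrite !mxE; ring.
  move=> E1 E2 E3; have {E3} : y = - x by lia.
  move=> ?; subst y; suff : x = 0 by lia.
  case: ha1 ne E1 E2 => ->; case: hb1 => ->; case: ha2 => ->; case: hb2 => -> ne; lia || by case: ne.
have [a ea] : exists a, a1 + a2 = 2 * a.
  by move: ha1 ha2 => [->|->] [->|->]; [exists 1|exists 0|exists 0|exists (-1)].
have [b eb] : exists b, b1 + b2 = 2 * b.
  by move: hb1 hb2 => [->|->] [->|->]; [exists 1|exists 0|exists 0|exists (-1)].
have [//||//] := @dvd2 _ _ 2 1 1 (t + a *: u + b *: w) S1 S2 i2.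
apply/rowP => i; rewrite !mxE !mulrDr !mulrA -ea -eb; ring.
Qed.

Variables (N : nat) (V : 'I_N -> 'rV[int]_r) (c : 'I_N -> k).
Hypothesis VS : forall i, S (V i).
(** Supplied by the induction hypothesis after contraction along u: the three terms are the classes
    that may lie over the image of w. *)
Hypothesis Cplane : forall u w, S u -> S w -> ind2 u w ->
  csum V c w + csum V c (w + u) + csum V c (w - u) = 0.

Let C := csum V c.

Let CN x : C (- x) = C x.
Proof. by apply: csum_eqpm; rewrite /eqpm eqxx orbT. Qed.

Let CS x : C x != 0 -> S x.
Proof.
move=> Cx; apply: contrapT => nS; case/eqP: Cx; apply: big1 => i /orP[]/eqP e.
  by case: nS; rewrite -e.
by case: nS; rewrite -[x]opprK -e; apply: SN.
Qed.

Lemma csum_shift u w : S u -> S w -> ind2 u w -> S (w + u) -> C (w + u) = - C w.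
Proof.
move=> Su Sw uw Swu; have := Cplane Su Sw uw; rewrite -!/(C _).
have -> : C (w - u) = 0.
  by apply: contrapT => /eqP/CS; apply: shift_excl Swu.
by rewrite addr0 addrC => /eqP; rewrite addr_eq0 => /eqP.
Qed.

Lemma ind2N (u w : 'rV[int]_r) : ind2 u w -> ind2 (- u) w.
Proof.
move=> uw x y e; have [] := uw (- x) y; last by lia.
by rewrite -[RHS]e scalerN scaleNr.
Qed.

Lemma ind2C (u w : 'rV[int]_r) : ind2 u w -> ind2 w u.
Proof. by move=> uw x y; rewrite addrC => /uw[-> ->]. Qed.

(* In a plane through u and w with third vector w + s u, each of the three
   vectors can play the role of u in Cplane, which leaves three equal values that
   are also opposite. *)
Lemma csum_triangle u w : C u != 0 -> C w != 0 -> ind2 u w ->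
  exists s : int, [/\ s = 1 \/ s = -1, S (w + s *: u),
    C (w + s *: u) = C u, C w = C u & C u + C u = 0].
Proof.
move=> Cu Cw uw; have Su := CS Cu; have Sw := CS Cw.
have [v vE Sv] : exists2 v, v = u \/ v = - u & S (w + v).
  have [Cp|Cp] := eqVneq (C (w + u)) 0; last by exists u; [left|exact: CS].
  exists (- u); first by right.
  apply/CS/eqP => Cm; case/eqP: Cw; rewrite /C.
  by have := Cplane Su Sw uw; rewrite -!/(C _) Cp Cm !addr0.
have Sv' : S v by case: vE => -> //; apply: SN.
have Cv : C v = C u by case: vE => ->.
have vw : ind2 v w by case: vE => -> //; apply: ind2N.
have E1 := csum_shift Sv' Sw vw Sv.
have E2 : C (w + v) = - C v.
  by rewrite addrC; apply: csum_shift => //; [exact: ind2C|rewrite addrC].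
have E3 : C v = - C w.
  rewrite -[C w]CN; apply/eqP; rewrite eq_sym eqr_oppLR; apply/eqP.
  have -> : - w = v + (- (w + v)) by rewrite opprD addrCA subrr addr0.
  apply: csum_shift => //; first exact: SN.
    move=> x y e; have [] := vw (y - x) (- x); last by lia.
    by rewrite -[RHS]e; apply/rowP => i; rewrite !mxE; ring.
  by rewrite opprD addrCA subrr addr0; apply: SN.
have Cvw : C w = C v by apply: oppr_inj; rewrite -E1 -E2.
have C2 : C u + C u = 0 by rewrite -Cv {1}E3 Cvw addNr.
have [s [s1 vs]] : exists s : int, (s = 1 \/ s = -1) /\ v = s *: u.
  by case: vE => ->; [exists 1|exists (-1)]; rewrite ?scale1r ?scaleN1r; split=> //; [left|right].
exists s; rewrite -vs -Cv; split=> //; last by rewrite Cv.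
by rewrite E2 {1}E3 opprK.
Qed.

(* In characteristic 2 the vectors with nonzero csum are closed under addition
   modulo 2; the Fano plane is excluded by the signs. *)
Lemma fano u w t : C u != 0 -> C w != 0 -> C t != 0 -> ind3 u w t -> S (w + u) ->
  C (w + u) = C u -> False.
Proof.
move=> Cu Cw Ct i3 Swu Cwu; have Su := CS Cu; have Sw := CS Cw; have St := CS Ct.
have iut : ind2 u t.
  by move=> x y e; have [|//] := i3 x 0 y; rewrite scale0r addr0.
have iwt : ind2 w t.
  by move=> x y e; have [|//] := i3 0 x y; rewrite scale0r add0r.
have iwut : ind2 (w + u) t.
  by move=> x y e; have [|//] := i3 x x y; rewrite -[RHS]e scalerDr [x *: u + _]addrC.
have [b [b1 S2 C2 _ _]] := csum_triangle Cu Ct iut.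
have [d [d1 S3 C3 _ _]] := csum_triangle Cw Ct iwt.
have [|p [p1 S4 _ _ _]] := csum_triangle _ Ct iwut; first by rewrite Cwu.
(* If d = b, then (w + u) + b (t + b u) - b (t + b w) = 2 u, against saturation of these three
   vectors. *)
have bd : d = - b.
  apply: contrapT => ne; have {}ne : d = b by lia.
  subst d; have i3' : ind3 (w + u) (t + b *: u) (t + b *: w).
    move=> x y z e; have [|] := i3 (x + b * y) (x + b * z) (y + z).
      by rewrite -[RHS]e; apply/rowP => i; rewrite !mxE; ring.
    by case: b1 => -> *; split; lia.
  have [//||//] := @dvd3 _ _ _ 2 1 b (- b) u Swu S2 S3 i3'.
  by apply/rowP => i; rewrite !mxE; case: b1 => ->; ring.
have [| |q [q1 S5 _ _ _]] := csum_triangle Cu (_ : C (t + d *: w) != 0) _.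
- by rewrite C3.
- move=> x y e; have [|] := i3 x (y * d) y.
    by rewrite -[RHS]e; apply/rowP => i; rewrite !mxE; ring.
  by move=> *; split.
have [| |q' [q'1 S6 _ _ _]] := csum_triangle Cw (_ : C (t + b *: u) != 0) _.
- by rewrite C2.
- move=> x y e; have [|] := i3 (y * b) x y.
    by rewrite -[RHS]e; apply/rowP => i; rewrite !mxE; ring.
  by move=> *; split.
(* The sign patterns (q, d), (b, q') and (p, p) on (u, w) must all agree, which forces d = b. *)
have [] := @sign_eq u w t q d b q' i3 q1 d1 b1 q'1; [by rewrite addrAC|by []|].
have [] := @sign_eq u w t p p b q' i3 p1 p1 b1 q'1 _ S6.
  by rewrite -addrA -scalerDr [u + w]addrC.
lia.
Qed.

Hypothesis rel : \sum_i c i *: (((V i)%:mx k)^T *m (V i)%:mx k) = 0.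

Let lin (l : 'cV[int]_r) (x : 'rV[int]_r) : k := ((x *m l) 0 0)%:~R.

Let rel_lin l l' : \sum_i c i * (lin l (V i) * lin l' (V i)) = 0.
Proof.
transitivity (((l%:mx k)^T *m (\sum_i c i *: (((V i)%:mx k)^T *m (V i)%:mx k))
    *m l'%:mx k) 0 0); last by rewrite rel mulmx0 mul0mx mxE.
rewrite mulmx_sumr mulmx_suml summxE.
apply: eq_bigr => i _; rewrite -scalemxAr -scalemxAl mxE; congr (_ * _).
by rewrite mulmxA -trmx_mul -mulmxA -!map_mxM mxE big_ord1 mxE ![map_mx _ _ _ _]mxE.
Qed.

Let linN l x : lin l (- x) = - lin l x.
Proof. by rewrite /lin mulNmx mxE rmorphN. Qed.

Lemma csum_eq0 u : u != 0 -> C u = 0.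
Proof.
move=> u0; apply/eqP/negPn/negP => Cu; have Su := CS Cu.
have FN l l' x : lin l (- x) * lin l' (- x) = lin l x * lin l' x.
  by rewrite !linN mulrNN.
have lin0 l : lin l 0 = 0 by rewrite /lin mul0mx mxE.
(* If u is alone in its class structure, the square of a linear form with value 1 at u reads off
   [C u]. Otherwise u lies in a triangle. *)
have [[w [uw Cw]]|no] := pselect (exists w, ind2 u w /\ C w != 0); last first.
  have [l ul] := saturated_rinv (sat1 Su u0).
  have := @sum_classes r N V c (fun x => lin l x * lin l x) u (FN _ _).
  have -> : lin l u = 1 by rewrite /lin ul mxE.
  rewrite rel_lin !mulr1 => Cu0.
  case/eqP: Cu; rewrite /C -Cu0 // => i nu.
  have [->|V0] := eqVneq (V i) 0; first by rewrite lin0 mulr0; left.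
  right; apply: contrapT => /eqP Ci; apply: no; exists (V i).
  by split=> //; apply: ind2S.
have [s [s1 Swv Cwv Cwu _]] := csum_triangle Cu Cw uw.
set v := s *: u in Swv Cwv.
have vE : eqpm v u.
  by rewrite /v; case: s1 => ->; rewrite /eqpm ?scale1r ?scaleN1r eqxx ?orbT.
have Cv : C v = C u by apply: csum_eqpm.
have vw : ind2 v w.
  by rewrite /v; case: s1 => ->; rewrite ?scale1r // scaleN1r; apply: ind2N.
have Sv : S v by apply: CS; rewrite Cv.
have [[t [t0 tv tw twv Ct]]|no] := pselect (exists t, [/\ t != 0, ~~ eqpm t v,
    ~~ eqpm t w, ~~ eqpm t (w + v) & C t != 0]).
  apply: (@fano v w t); rewrite ?Cv //.
  by apply: ind3S => //; apply: CS.
(* Only the triangle v, w, w + v remains. The product of the forms dual to v and w vanishes at v and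
   w and is 1 at w + v. *)
have [B AB] := saturated_rinv (sat2 Sv (CS Cw) vw).
pose l := lsubmx B; pose l' := rsubmx B.
have lE : [/\ lin l v = 1, lin l w = 0, lin l' v = 0 & lin l' w = 1].
  move: AB; rewrite -[B]hsubmxK mul_col_row -/l -/l' (@scalar_mx_block _ 1 1).
  by case/eq_block_mx => E1 E2 E3 E4; rewrite /lin E1 E2 E3 E4 !mxE eqxx.
have linD m x y : lin m (x + y) = lin m x + lin m y.
  by rewrite /lin mulmxDl mxE rmorphD.
have [l1 l2 l3 l4] := lE.
have := @sum_classes r N V c (fun x => lin l x * lin l' x) (w + v) (FN _ _).
rewrite rel_lin !linD l1 l2 l3 l4 add0r addr0 !mulr1 => Cu0.
case/eqP: Cu; rewrite -Cwv /C -Cu0 // => i nwv.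
have [->|V0] := eqVneq (V i) 0; first by rewrite lin0 mul0r; left.
have [/orP[]/eqP->|nv] := boolP (eqpm (V i) v).
- by left; rewrite l3 mulr0.
- by left; rewrite linN [lin l' _]linN l3 oppr0 mulr0.
have [/orP[]/eqP->|nw] := boolP (eqpm (V i) w).
- by left; rewrite l2 mul0r.
- by left; rewrite linN l2 oppr0 mul0r.
by right; apply: contrapT => /eqP Ci; apply: no; exists (V i).
Qed.

End System.

Definition unimodular_system r (S : 'rV[int]_r -> Prop) : Prop :=
  (forall x, S x -> S (- x)) /\
  (forall n (A : 'M_(n, r)), (forall i, S (row i A)) -> zfree A -> saturated A).

(** The map [pi] drops the first coordinate in a basis starting with u. An independent family in the
    image lifts to S and stays independent when u is added; saturation of the larger family
    descends. *)
Lemma system_contract r (S : 'rV[int]_r.+1 -> Prop) u :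
  unimodular_system S -> S u -> u != 0 ->
  exists pi : 'M[int]_(r.+1, r), [/\ u *m pi = 0,
    forall x : 'rV_r.+1, x *m pi = 0 -> exists t : int, x = t *: u &
    unimodular_system (fun y : 'rV_r => exists2 x, S x & y = x *m pi)].
Proof.
move=> [SN Ssat] Su u0.
have [_ [P uP uE]] := saturated_completion (sat1 Ssat Su u0).
pose Pi : 'M_(1 + r, 1 + r) := invmx P.
pose pi := rsubmx Pi; exists pi.
have piE m (X : 'M_(m, 1 + r)) : X *m pi = rsubmx (X *m Pi).
  by rewrite -[Pi in RHS]hsubmxK mul_mx_row row_mxKr.
have upi : u *m pi = 0.
  by rewrite piE uE mulmxK // (@pid_mx_row _ r 1) row_mxKr.
have kerpi x : x *m pi = 0 -> exists t : int, x = t *: u.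
  move=> x0; exists ((x *m Pi) 0 0).
  rewrite uE scalemxAl -[LHS](mulmxKV uP); congr (_ *m P).
  rewrite -/Pi; apply/rowP => j; rewrite [RHS]mxE [pid_mx _ _ _]mxE.
  case: (unliftP 0 j) => [j' ->|-> /=]; last by rewrite mulr1.
  move: x0; rewrite piE => /rowP/(_ j'); rewrite !mxE -rshift1 /= => ->.
  by rewrite mulr0.
split=> //; split=> [y [x Sx ->]|n A' SA' A'f q y' z q0 e].
  by exists (- x); [apply: SN|rewrite mulNmx].
have /choice[a aP] : forall i : 'I_n, exists x, S x /\ row i A' = x *m pi.
  by move=> i; have [x] := SA' i; exists x.
pose A := \matrix_i a i.
have AE : A' = A *m pi.
  by apply/row_matrixP => i; rewrite row_mul rowK; case: (aP i).
have [sg sgpi] : exists sg : 'M_(r, r.+1), sg *m pi = 1%:M.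
  exists (row_mx 0 1%:M *m (P : 'M_(1 + r))).
  by rewrite piE mulmxK // row_mxKr.
have [|t et] := kerpi (q *: (y' *m sg) - z *m A).
  rewrite mulmxBl -scalemxAl -[y' *m sg *m pi]mulmxA sgpi mulmx1 e AE.
  by rewrite mulmxA subrr.
have sA : saturated (col_mx u A).
  apply: Ssat => [i|w].
    rewrite -[i]splitK; case: split => j /=; first by rewrite rowKu row_id.
    by rewrite rowKd rowK; case: (aP j).
  rewrite -[w]hsubmxK mul_row_col => w0.
  have w2 : rsubmx w = 0.
    apply: A'f; rewrite AE mulmxA; have := congr1 (mulmx^~ pi) w0.
    by rewrite /= mulmxDl -[_ *m u *m pi]mulmxA upi mulmx0 add0r mul0mx.
  move: w0; rewrite w2 mul0mx addr0 => /(zfree1 u0)->.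
  exact: row_mx0.
have [|w ew] := sA q (y' *m sg) (row_mx t%:M z) q0.
  by rewrite mul_row_col mul_scalar_mx -et subrK.
by exists (rsubmx w); rewrite -[LHS](row_mxKr t%:M) ew linearZ.
Qed.

(** Over the image of w, up to sign, S has at most the vectors w + t u with t in {0, 1, -1}, by
    [shift_unit]; their classes are disjoint since u and w are independent. *)
Lemma csum_plane r r' (S : 'rV[int]_r -> Prop) N (V : 'I_N -> 'rV_r)
    (c : 'I_N -> k) (u w : 'rV_r) (pi : 'M_(r, r')) :
  unimodular_system S -> u *m pi = 0 ->
  (forall x : 'rV_r, x *m pi = 0 -> exists t : int, x = t *: u) ->
  (forall i, S (V i)) -> S u -> S w -> ind2 u w ->
  csum (fun i => V i *m pi) c (w *m pi) = 0 ->
  csum V c w + csum V c (w + u) + csum V c (w - u) = 0.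
Proof.
move=> [SN Ssat] upi kerpi VS Su Sw uw C0.
suff : csum V c (w + 0 *: u) + csum V c (w + 1 *: u) +
    csum V c (w + (-1) *: u) = 0 by rewrite scale0r addr0 scale1r scaleN1r.
have shift_inj (t t' : int) : eqpm (w + t *: u) (w + t' *: u) -> t = t'.
  case/orP => /eqP e.
    have [|] := uw (t - t') 0; last by lia.
    by rewrite scale0r addr0 scalerBl; apply/eqP; rewrite subr_eq0; apply/eqP/(addrI w).
  have [|] := uw (t + t') 2; last by lia.
  have := congr1 (+%R^~ (w + t' *: u)) e; rewrite addNr => <-.
  by apply/rowP => i; rewrite !mxE; ring.
have dec i : eqpm (V i *m pi) (w *m pi) = [|| eqpm (V i) (w + 0 *: u),
    eqpm (V i) (w + 1 *: u) | eqpm (V i) (w + (-1) *: u)].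
  apply/idP/idP => [e|/or3P[]/orP[]/eqP->]; last first.
  1-6: by rewrite ?mulNmx mulmxDl -scalemxAl upi scaler0 addr0 /eqpm eqxx ?orbT.
  have [t Vt] : exists t : int, eqpm (V i) (w + t *: u).
    case/orP: e => /eqP eV.
      have [|t et] := kerpi (V i - w); first by rewrite mulmxBl eV subrr.
      by exists t; rewrite -et addrC subrK /eqpm eqxx.
    have [|t et] := kerpi (V i + w); first by rewrite mulmxDl eV addNr.
    by exists (- t); rewrite scaleNr -et opprD addrCA subrr addr0 /eqpm opprK eqxx orbT.
  have : S (w + t *: u).
    by case/orP: Vt => /eqP eV; [rewrite -eV|rewrite -[_ + _]opprK -eV; apply: SN].
  by move=> /(shift_unit Ssat Sw uw)[t0|[t0|t0]]; subst t; rewrite Vt ?orbT.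
have excl i (t t' : int) : t != t' ->
    eqpm (V i) (w + t *: u) -> eqpm (V i) (w + t' *: u) = false.
  move=> tt'; rewrite eqpmC => e; apply/negP => e'; case/eqP: tt'.
  by apply: shift_inj; have [_ /(_ e) ->] := eqpm_equiv (w + t *: u) (V i) (w + t' *: u).
rewrite -[RHS]C0 /csum (eq_bigl _ _ dec) [RHS]big_mkcond /=.
rewrite [X in X + _ + _]big_mkcond [X in _ + X + _]big_mkcond.
rewrite [X in _ + X]big_mkcond /= -!big_split /=.
apply: eq_bigr => i _; have [e0|_] := boolP (eqpm (V i) (w + 0 *: u)).
  by rewrite (excl i 0 1) // (excl i 0 (-1)) //= !addr0.
have [e1|_] := boolP (eqpm (V i) (w + 1 *: u)).
  by rewrite (excl i 1 (-1)) //= add0r addr0.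
by rewrite /= !add0r.
Qed.

(** Induction on the ambient rank, the relation being carried to the contraction by congruence with
    [pi]. The class of 0 must be left out: contraction sends u there, and its form is zero. *)
Theorem unimodular_relation r (S : 'rV[int]_r -> Prop) :
  unimodular_system S -> forall N (V : 'I_N -> 'rV_r) (c : 'I_N -> k),
  (forall i, S (V i)) ->
  \sum_i c i *: (((V i)%:mx k)^T *m (V i)%:mx k) = 0 ->
  forall w, w != 0 -> csum V c w = 0.
Proof.
elim: r S => [|r IH] S sysS N V c VS rel w w0.
  by case/eqP: w0; apply/rowP => -[].
have [SN Ssat] := sysS.
apply: (csum_eq0 SN Ssat VS _ rel) w0 => {}w0 {}w Su Sw uw.
have [u0 _] := ind2_neq0 uw.
have [pi [upi kerpi syspi]] := system_contract sysS Su u0.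
apply: (csum_plane sysS upi kerpi VS Su Sw uw).
apply: (IH _ syspi) => [i||]; first by exists (V i).
  have := congr1 (fun X => (pi%:mx k)^T *m X *m pi%:mx k) rel.
  rewrite mulmx0 mul0mx mulmx_sumr mulmx_suml => e; rewrite -[RHS]e.
  apply: eq_bigr => i _; rewrite -scalemxAr -scalemxAl; congr (_ *: _).
  by rewrite map_mxM trmx_mul !mulmxA.
apply/eqP => /kerpi[t wt]; have [|_] := uw t (- 1); last by [].
by rewrite scaleN1r -wt subrr.
Qed.

End Unimodular.

(** * Coordinates with respect to minimal vectors *)

Section Dist.
Variable R : realType.
Implicit Type a b : R.

Definition nint a : int := Num.floor (a + 2^-1).
Definition dist a : R := `|a - (nint a)%:~R|.

Lemma dist_le a : dist a <= 2^-1.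
Proof.
rewrite /dist /nint; have := floor_itv (a + 2^-1).
move: (Num.floor _) => z; rewrite intrD => /andP[h1 h2].
rewrite ler_norml; apply/andP; split; lra.
Qed.

Lemma dist_ge0 a : 0 <= dist a. Proof. exact: normr_ge0. Qed.

Lemma dist_min a (z : int) : dist a <= `|a - z%:~R|.
Proof.
have [->|zn] := eqVneq z (nint a); first by [].
apply: (le_trans (dist_le a)).
have h1 : 1 <= `|z%:~R - (nint a)%:~R : R|.
  by rewrite -intrB -intr_norm (ler_int _ 1); lia.
have := ler_distD a z%:~R (nint a)%:~R; rewrite [`|_ - a|]distrC.
have := dist_le a; rewrite /dist; lra.
Qed.

(** If a is at distance d from its nearest integer n, then 2 a is at distance 1 - 2 d from 2 n + 1
    or from 2 n - 1. *)
Lemma dist_double a : dist (a + a) <= 1 - 2 * dist a.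
Proof.
have d2 := dist_le a.
have [h|h] := lerP 0 (a - (nint a)%:~R).
  apply: le_trans (dist_min _ (nint a + nint a + 1)) _.
  rewrite /dist ger0_norm // in d2 *; rewrite !intrD ler0_norm; lra.
apply: le_trans (dist_min _ (nint a + nint a - 1)) _.
rewrite /dist ltr0_norm // in d2 *; rewrite !intrD rmorphN ger0_norm; lra.
Qed.

Lemma dist_half a : dist a = 2^-1 -> a - 2^-1 \is a Num.int.
Proof.
rewrite /dist; have [h|h] := lerP 0 (a - (nint a)%:~R).
  by rewrite ger0_norm // => <-; rewrite opprB addrCA subrr addr0 intr_int.
rewrite ltr0_norm // => e; have -> : a - 2^-1 = (nint a - 1)%:~R.
  rewrite intrB; lra.
by rewrite intr_int.
Qed.

Lemma half_nint : (2^-1 : R) \isn't a Num.int.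
Proof.
apply/negP => /intrP[m mE]; have : (m + m)%:~R = 1 :> R by rewrite intrD -mE; lra.
by rewrite -[1]/(1%:~R) => /intr_inj; lia.
Qed.

Lemma int_half a : a + a \is a Num.int -> a \isn't a Num.int -> a - 2^-1 \is a Num.int.
Proof.
move=> /intrP[m e] na; have [k [ek|ek]] : exists k : int, m = 2 * k \/ m = 2 * k + 1.
- exists (m %/ 2)%Z; lia.
- case/negP: na; suff -> : a = k%:~R by rewrite intr_int.
  by move: e; rewrite ek intrM; lra.
suff -> : a - 2^-1 = k%:~R by rewrite intr_int.
by move: e; rewrite ek intrD intrM; lra.
Qed.

End Dist.

(** * Independence of integer vectors over a field *)

Section Independence.
Variable g : nat.
Implicit Type k : fieldType.

Definition fam_mx n (e : 'I_n -> 'cV[int]_g) : 'M[int]_(n, g) :=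
  \matrix_i (e i)^T.

Definition indep k n (e : 'I_n -> 'cV[int]_g) : bool :=
  row_free ((fam_mx e)%:mx k).

Lemma fam_mxE k n (e : 'I_n -> 'cV[int]_g) (a : 'rV[k]_n) :
  (a *m (fam_mx e)%:mx k)^T = \sum_i a 0 i *: (e i)%:mx k.
Proof.
rewrite mulmx_sum_row linear_sum; apply: eq_bigr => i _.
by rewrite linearZ /= -map_row rowK map_trmx trmxK.
Qed.

Lemma indepP k n (e : 'I_n -> 'cV[int]_g) :
  indep k e <-> forall a : 'I_n -> k,
    \sum_i a i *: (e i)%:mx k = 0 -> forall i, a i = 0.
Proof.
split=> [fe a ae i|fe].
  have /rowP/(_ i) : \row_i a i = 0.
    apply: (row_free_inj fe); rewrite mul0mx; apply: trmx_inj.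
    by rewrite fam_mxE trmx0 -[RHS]ae; apply: eq_bigr => j _; rewrite mxE.
  by rewrite !mxE.
apply/inj_row_free => a ae; apply/rowP => i; rewrite mxE.
by apply: (fe (fun i => a 0 i)); rewrite -fam_mxE ae trmx0.
Qed.

Definition in_span k n (e : 'I_n -> 'cV[int]_g) (x : 'cV[int]_g) : Prop :=
  exists a : 'I_n -> k, x%:mx k = \sum_i a i *: (e i)%:mx k.

Lemma in_span_sub k n (e : 'I_n -> 'cV[int]_g) x :
  in_span k e x <-> (x^T%:mx k <= (fam_mx e)%:mx k)%MS.
Proof.
split=> [[a ea]|/submxP[D eD]].
  apply/submxP; exists (\row_i a i); apply: trmx_inj.
  rewrite fam_mxE map_trmx trmxK ea.
  by apply: eq_bigr => i _; rewrite mxE.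
exists (fun i => D 0 i); rewrite -fam_mxE -eD.
by rewrite map_trmx trmxK.
Qed.

Lemma separating_vector (R : realType) n (e : 'I_n -> 'cV[int]_g) v :
  ~ in_span R e v -> exists y : 'cV[R]_g,
    (forall w, in_span R e w -> ((realify R w)^T *m y) 0 0 = 0) /\
    ((realify R v)^T *m y) 0 0 != 0.
Proof.
move=> nv; have {nv} : ~~ (v^T%:mx R <= (fam_mx e)%:mx R)%MS.
  by apply/negP => /in_span_sub.
rewrite submxE => /rV0Pn[l yl]; set K := cokermx _ in yl.
have E w : ((realify R w)^T *m col l K) 0 0 = (w^T%:mx R *m K) 0 l.
  by rewrite !mxE; apply: eq_bigr => j _; rewrite !mxE.
exists (col l K); split=> [w|]; rewrite E // => /in_span_sub.
by rewrite submxE -/K => /eqP ->; rewrite mxE.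
Qed.

Lemma in_span_mem k n (e : 'I_n -> 'cV[int]_g) i : in_span k e (e i).
Proof.
exists (fun j => (i == j)%:R); rewrite (bigD1 i) //= eqxx scale1r big1 ?addr0 //.
by move=> j; rewrite eq_sym => /negPf->; rewrite scale0r.
Qed.

Lemma indep_basis k n (v : 'I_n -> 'cV[int]_g) : exists r (f : 'I_r -> 'I_n),
  [/\ r = \rank ((fam_mx v)%:mx k), injective f, indep k (v \o f) &
      forall j, in_span k (v \o f) (v j)].
Proof.
set A := (fam_mx v)%:mx k; exists (\rank A), (maxrankfun A).
have E : (fam_mx (v \o maxrankfun A))%:mx k = rowsub (maxrankfun A) A.
  by apply/matrixP => i j; rewrite !mxE.
split=> //; first exact: maxrankfun_inj.
  by rewrite /indep E maxrowsub_free.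
move=> j; apply/in_span_sub; rewrite E eq_maxrowsub.
have -> : (v j)^T%:mx k = row j A by rewrite -map_row rowK.
exact: row_sub.
Qed.

(** A maximal minor that is nonzero in k, possibly ['F_p], is a nonzero integer, hence nonzero in
    characteristic 0. *)
Lemma indep_intr k (k' : numFieldType) n (e : 'I_n -> 'cV[int]_g) :
  indep k e -> indep k' e.
Proof.
rewrite /indep; move: (fam_mx e) => A fA.
have fA' : row_full ((A%:mx k)^T) by rewrite /row_full mxrank_tr.
have u := fullrowsub_unit fA'; set f := fullrankfun fA' in u.
have eD k0 : rowsub f ((A%:mx k0)^T) = (rowsub f A^T)%:mx k0.
  by apply/matrixP => i j; rewrite !mxE.
have d0 : \det (rowsub f A^T) != 0.
  apply: contraTneq u => d0.
  by rewrite eD unitmxE det_map_mx d0 rmorph0 unitr0.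
have u' : rowsub f ((A%:mx k')^T) \in unitmx.
  by rewrite eD unitmxE det_map_mx unitfE intr_eq0.
apply/inj_row_free => z zA; apply: trmx_inj; rewrite trmx0.
rewrite -[LHS](mulKmx u') mul_rowsub_mx -trmx_mul zA trmx0.
by rewrite (_ : rowsub f 0 = 0) ?mulmx0 //; apply/matrixP => i j; rewrite !mxE.
Qed.

Lemma indep_cons k n (e : 'I_n -> 'cV[int]_g) x : indep k e -> ~ in_span k e x ->
  indep k (fun i : 'I_n.+1 => if unlift ord0 i is Some j then e j else x).
Proof.
move=> /indepP fe nx; apply/indepP => a.
rewrite big_ord_recl unlift_none => ae.
have a0 : a ord0 = 0.
  apply: contrapT => /eqP a0; apply: nx; exists (fun i => - (a ord0)^-1 * a (lift ord0 i)).
  apply/eqP; rewrite -subr_eq0 -sumrN; apply/eqP/(scalemx_inj a0).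
  rewrite scaler0 -[RHS]ae scalerDr; congr (_ + _); rewrite scaler_sumr.
  apply: eq_bigr => i _; rewrite liftK mulNr scaleNr opprK scalerA mulrA mulfV //.
  by rewrite mul1r.
move: ae; rewrite a0 scale0r add0r => ae i.
case: (unliftP ord0 i) => [j ->|-> //]; apply: (fe (fun j => a (lift ord0 j))).
by rewrite -[RHS]ae; apply: eq_bigr => l _; rewrite liftK.
Qed.

Lemma indep_lift k n (e : 'I_n.+1 -> 'cV[int]_g) j :
  indep k e -> indep k (fun i => e (lift j i)).
Proof.
move=> /indepP fe; apply/indepP => a ae i.
have := fe (fun i => if unlift j i is Some l then a l else 0) _ (lift j i).
rewrite liftK; apply; rewrite (bigD1_ord j) //= unlift_none scale0r add0r.
by rewrite -[RHS]ae; apply: eq_bigr => l _; rewrite liftK.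
Qed.

Lemma indep_exchange k n (e : 'I_n -> 'cV[int]_g) x (b : 'I_n -> k) j :
  indep k e -> x%:mx k = \sum_i b i *: (e i)%:mx k -> b j != 0 ->
  indep k (fun i => if i == j then x else e i).
Proof.
move=> /indepP fe xe bj; apply/indepP => a ae.
have E i : a j * b i + (if i == j then 0 else a i) = 0.
  apply: (fe (fun i => a j * b i + (if i == j then 0 else a i))).
  rewrite -[RHS]ae [RHS](bigD1 j) //= eqxx xe scaler_sumr.
  rewrite [X in _ = _ + X](_ : _ = \sum_i (if i == j then 0 else a i) *: (e i)%:mx k).
    by rewrite -big_split /=; apply: eq_bigr => l _; rewrite scalerDl scalerA.
  rewrite [RHS](bigD1 j) //= eqxx scale0r add0r.
  by apply: eq_bigr => l /negPf->.
have aj : a j = 0.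
  by have /eqP := E j; rewrite eqxx addr0 mulf_eq0 (negPf bj) orbF => /eqP.
move=> i; have [->//|ij] := eqVneq i j.
by have := E i; rewrite aj (negPf ij) mul0r add0r.
Qed.

End Independence.

Section Form.
Variables (R : realType) (g : nat) (Q : 'M[R]_g).
Hypothesis pdQ : positive_definite Q.

Local Notation rv := (@realify R g 1).
Local Notation q v := (qform Q (rv v)).
Local Notation Min := (Min Q).

Definition bform (x y : 'cV[R]_g) : R := (x^T *m Q *m y) 0 0.

Lemma bformC x y : bform x y = bform y x.
Proof.
have -> : bform x y = (x^T *m Q *m y)^T 0 0 by rewrite mxE.
by rewrite !trmx_mul trmxK pdQ.1 mulmxA.
Qed.

Lemma bformDr x y z : bform x (y + z) = bform x y + bform x z.
Proof. by rewrite /bform mulmxDr mxE. Qed.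

Lemma bformZr x a y : bform x (a *: y) = a * bform x y.
Proof. by rewrite /bform -scalemxAr mxE. Qed.

Lemma bform_sumr n x (a : 'I_n -> R) y :
  bform x (\sum_i a i *: y i) = \sum_i a i * bform x (y i).
Proof.
rewrite /bform mulmx_sumr summxE; apply: eq_bigr => i _.
by rewrite -scalemxAr mxE.
Qed.

Lemma qformE x : qform Q x = bform x x. Proof. by []. Qed.

Lemma qformD x y : qform Q (x + y) = qform Q x + 2 * bform x y + qform Q y.
Proof.
rewrite !qformE bformDr ![bform (x + y) _]bformC !bformDr [bform y x]bformC; ring.
Qed.

Lemma qformN x : qform Q (- x) = qform Q x.
Proof.
by rewrite !qformE -scaleN1r bformZr bformC bformZr mulrA mulrNN mulr1 mul1r.
Qed.

Lemma qformB x y : qform Q (x - y) = qform Q x - 2 * bform x y + qform Q y.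
Proof. by rewrite qformD qformN -scaleN1r bformZr; ring. Qed.

Lemma rvE x : rv x = x%:mx R. Proof. by []. Qed.
Lemma rvD x y : rv (x + y) = rv x + rv y. Proof. exact: map_mxD. Qed.
Lemma rvB x y : rv (x - y) = rv x - rv y. Proof. exact: map_mxB. Qed.
Lemma rvN x : rv (- x) = - rv x. Proof. exact: map_mxN. Qed.
Lemma rvZ (z : int) x : rv (z *: x) = z%:~R *: rv x. Proof. exact: map_mxZ. Qed.
Lemma rv0 : rv 0 = 0. Proof. exact: map_mx0. Qed.
Lemma rv_sum n (x : 'I_n -> 'cV_g) : rv (\sum_i x i) = \sum_i rv (x i).
Proof. by rewrite !rvE raddf_sum. Qed.

Lemma rv_inj : injective rv.
Proof.
move=> x y /colP e; apply/colP => i; have := e i; rewrite !mxE.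
exact: intr_inj.
Qed.

Lemma rv_eq0 x : (rv x == 0) = (x == 0).
Proof. by rewrite -rv0 (inj_eq rv_inj). Qed.

Lemma Min_neq0 v : Min v -> v != 0. Proof. by case. Qed.

Lemma Min_le v w : Min v -> w != 0 -> q v <= q w.
Proof. by case=> _ _ h /h; apply. Qed.

Lemma Min_eq v w : Min v -> Min w -> q v = q w.
Proof. by move=> Mv Mw; apply: le_anti; rewrite !Min_le ?Min_neq0. Qed.

Lemma MinP v w : Min v -> w != 0 -> q w <= q v -> Min w.
Proof. by move=> Mv w0 le; split=> // x _ x0; apply: le_trans le _; apply: Min_le. Qed.

Lemma MinN v : Min v -> Min (- v).
Proof.
move=> Mv; apply: (MinP Mv); first by rewrite oppr_eq0 Min_neq0.
by rewrite rvN qformN.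
Qed.

Lemma q_gt0 v : v != 0 -> 0 < q v.
Proof. by move=> v0; apply: pdQ.2; rewrite rv_eq0. Qed.

Lemma Min_indep2 v w : Min v -> Min w -> v != w -> v != - w ->
  ~ in_span R (fun _ : 'I_1 => v) w.
Proof.
move=> Mv Mw vw vNw [a]; rewrite big_ord1 -!rvE => e.
have := Min_eq Mw Mv; rewrite e qformE bformZr bformC bformZr -qformE.
move=> /eqP; rewrite mulrA -subr_eq0 -{2}[qform _ _]mul1r -mulrBl mulf_eq0.
rewrite (gt_eqF (q_gt0 (Min_neq0 Mv))) orbF subr_eq0 -expr2 sqrf_eq1.
case/orP => /eqP a1; move: e; rewrite a1.
  by rewrite scale1r => /rv_inj e; rewrite e eqxx in vw.
by rewrite scaleN1r -rvN => /rv_inj e; rewrite e opprK eqxx in vNw.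
Qed.

Lemma q_combination n (v : 'I_n -> 'cV[int]_g) (t : 'I_n -> R) x :
  rv x = \sum_i t i *: rv (v i) ->
  \sum_i t i * (q (x - v i) - q (v i)) = (\sum_i t i - 2) * q x.
Proof.
move=> xE; transitivity (\sum_i t i * q x - 2 * bform (rv x) (rv x)).
  have -> : bform (rv x) (rv x) = \sum_i t i * bform (rv x) (rv (v i)).
    by rewrite {2}xE bform_sumr.
  rewrite mulr_sumr -sumrB; apply: eq_bigr => i _.
  by rewrite rvB qformB; ring.
by rewrite -mulr_suml qformE; ring.
Qed.

Lemma weight_ge2 n (v : 'I_n -> 'cV[int]_g) (t : 'I_n -> R) x :
  (forall i, Min (v i)) -> (forall i, 0 <= t i) ->
  rv x = \sum_i t i *: rv (v i) -> x != 0 -> (forall i, x != v i) ->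
  2 <= \sum_i t i.
Proof.
move=> Mv t0 xE x0 xv; rewrite -subr_ge0 -(pmulr_lge0 _ (q_gt0 x0)).
rewrite -(q_combination xE) sumr_ge0 // => i _; rewrite mulr_ge0 // subr_ge0.
by rewrite Min_le // subr_eq0.
Qed.

(** Subtracting nearest integers and flipping signs of the [e i] leaves the coefficients
    [dist (a i)], to which [weight_ge2] applies. The reduced vector is none of the flipped ones, as
    its coefficients are at most 1/2. *)
Lemma dist_sum n (e : 'I_n -> 'cV[int]_g) (a : 'I_n -> R) x :
  (forall i, Min (e i)) -> indep R e -> rv x = \sum_i a i *: rv (e i) ->
  ~ (forall i, a i \is a Num.int) -> 2 <= \sum_i dist (a i).
Proof.
move=> Me /indepP fe xE na; pose b i := a i - (nint (a i))%:~R.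
pose x' := x - \sum_i nint (a i) *: e i.
have x'E : rv x' = \sum_i b i *: rv (e i).
  rewrite rvB rv_sum xE -sumrB; apply: eq_bigr => i _.
  by rewrite rvZ scalerBl.
pose v i := if 0 <= b i then e i else - e i.
have bE i : dist (a i) *: rv (v i) = b i *: rv (e i).
  rewrite /v /dist -/(b i); have [b0|b0] := lerP 0 (b i).
    by rewrite ger0_norm.
  by rewrite ltr0_norm // rvN scalerN scaleNr opprK.
apply: (@weight_ge2 _ v _ x') => [i|i||  |i].
- by rewrite /v; case: ifP => // _; apply: MinN.
- exact: dist_ge0.
- by rewrite x'E; apply: eq_bigr => i _; rewrite bE.
- apply/eqP => x'0; apply: na => i.
  have : b i = 0 by apply: fe; rewrite -x'E x'0 rv0.
  by move/eqP; rewrite subr_eq0 => /eqP->; rewrite intr_int.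
- apply/eqP => xv; pose s : R := if 0 <= b i then 1 else -1.
  have vs : rv (v i) = s *: rv (e i).
    by rewrite /v /s; case: ifP => _; rewrite ?scale1r // rvN scaleN1r.
  have bs : b i - s = 0.
    have := fe (fun j => b j - (if j == i then s else 0)) _ i; rewrite eqxx.
    apply; under eq_bigr do rewrite scalerBl; rewrite sumrB -x'E xv vs.
    rewrite (bigD1 i) //= eqxx big1 ?addr0 ?subrr // => j /negPf->.
    by rewrite scale0r.
  have s1 : `|s| = 1 by rewrite /s; case: ifP; rewrite ?normrN normr1.
  have := dist_le (a i); rewrite /dist -/(b i) (subr0_eq bs) s1; lra.
Qed.

Lemma sum_dist_le n (a : 'I_n -> R) : \sum_i dist (a i) <= n%:R / 2.
Proof.
apply: le_trans (_ : \sum_(i < n) 2^-1 <= _).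
  by apply: ler_sum => i _; apply: dist_le.
by rewrite sumr_const card_ord -[X in X *+ _]mul1r mulrnAl.
Qed.

(** At most four numbers, each at most 1/2, add up to at least 2 only if there are four and all are
    equal to 1/2. *)
Lemma coords_small n (e : 'I_n -> 'cV[int]_g) (a : 'I_n -> R) x : (n <= 4)%N ->
  (forall i, Min (e i)) -> indep R e -> rv x = \sum_i a i *: rv (e i) ->
  (forall i, a i \is a Num.int) \/ n = 4%N /\ (forall i, a i - 2^-1 \is a Num.int).
Proof.
move=> n4 Me fe xE; have [?|na] := pselect (forall i, a i \is a Num.int); [by left|right].
have h1 := dist_sum Me fe xE na; have h2 := sum_dist_le a.
have n4' : n = 4%N.
  apply/eqP; rewrite eqn_leq n4 -(ler_nat R); lra.
split=> // i; apply: dist_half; apply/le_anti/andP; split; first exact: dist_le.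
move: h1; rewrite (bigD1 i) //= => h1.
have : \sum_(j < n | j != i) dist (a j) <= \sum_(j < n | j != i) 2^-1.
  by apply: ler_sum => j _; apply: dist_le.
have : \sum_(j < n) 2^-1 = 2 :> R.
  by rewrite n4' sumr_const card_ord; lra.
rewrite (bigD1 i) //=; lra.
Qed.

(* The only obstruction to integrality of coordinates in at most four independent
   minimal vectors, see coords_small. *)
Definition D4_free := forall (e : 'I_4 -> 'cV[int]_g) x,
  (forall i, Min (e i)) -> indep R e -> rv x <> \sum_i 2^-1 *: rv (e i).

Lemma half_vector n (e : 'I_n -> 'cV[int]_g) (a : 'I_n -> R) x :
  rv x = \sum_i a i *: rv (e i) -> (forall i, a i - 2^-1 \is a Num.int) ->
  exists y, rv y = \sum_i 2^-1 *: rv (e i).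
Proof.
move=> xE ha; have /choice[z zE] : forall i, exists z : int, a i - 2^-1 = z%:~R.
  by move=> i; apply/intrP.
exists (x - \sum_i z i *: e i); rewrite rvB rv_sum xE -sumrB.
by apply: eq_bigr => i _; rewrite rvZ -scalerBl -zE opprB addrCA subrr addr0.
Qed.

Section D4free.
Hypothesis nD4 : D4_free.

Lemma coords_int n (e : 'I_n -> 'cV[int]_g) (a : 'I_n -> R) x : (n <= 4)%N ->
  (forall i, Min (e i)) -> indep R e -> rv x = \sum_i a i *: rv (e i) ->
  forall i, a i \is a Num.int.
Proof.
move=> n4 Me fe xE; have [//|[n4' ha]] := coords_small n4 Me fe xE.
by subst n; have [y /nD4] := half_vector xE ha; case.
Qed.

Lemma coords5 (e : 'I_5 -> 'cV[int]_g) (a : 'I_5 -> R) x :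
  (forall i, Min (e i)) -> indep R e -> rv x = \sum_i a i *: rv (e i) ->
  (forall i, a i \is a Num.int) \/ (forall i, a i - 2^-1 \is a Num.int).
Proof.
move=> Me fe xE; have [?|na] := pselect (forall i, a i \is a Num.int); [by left|right].
(* An integral coordinate can be subtracted off; the rest lies in the span of four minimal vectors,
   where all coordinates are integral. *)
have nai j : a j \isn't a Num.int.
  apply/negP => /intrP[z zE]; apply: na.
  have aj := coords_int (x := x - z *: e j) (a := fun i => a (lift j i)) (leqnn 4)
    (fun i => Me (lift j i)) (indep_lift j fe).
  move=> i; case: (unliftP j i) => [l ->|->]; last by rewrite zE intr_int.
  apply: aj; rewrite rvB rvZ -zE xE (bigD1_ord j) //=.
  by rewrite addrAC subrr add0r.
(* Otherwise the distances to Z of the a i and of the 2 (a i) both add up to at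
   least 2, against dist (2 a) <= 1 - 2 dist a. *)
have [h|nh] := pselect (forall i, a i + a i \is a Num.int).
  by move=> i; apply: int_half.
have h1 := dist_sum Me fe xE na.
have h2 : 2 <= \sum_i dist (a i + a i).
  apply: (dist_sum (x := x + x) Me fe _ nh); rewrite rvD xE -big_split /=.
  by apply: eq_bigr => i _; rewrite scalerDl.
have : \sum_i dist (a i + a i) <= \sum_i (1 - 2 * dist (a i)).
  by apply: ler_sum => i _; apply: dist_double.
rewrite sumrB -mulr_sumr sumr_const card_ord; lra.
Qed.

End D4free.

End Form.

(** * Relations between the rank one forms of minimal vectors *)

Lemma trmxZ (k : nzRingType) m n (a : k) (X : 'M[k]_(m, n)) :
  (a *: X)^T = a *: X^T.
Proof. by apply/matrixP => i j; rewrite !mxE. Qed.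

Lemma trmxN (k : nzRingType) m n (X : 'M[k]_(m, n)) : (- X)^T = - X^T.
Proof. by apply/matrixP => i j; rewrite !mxE. Qed.

Section Relations.
Variable g : nat.

Definition pm_distinct N (v : 'I_N -> 'cV[int]_g) : Prop :=
  forall i j, v i = v j \/ v i = - v j -> i = j.

Lemma pm_distinct_comp N n (v : 'I_N -> 'cV[int]_g) (h : 'I_n -> 'I_N) :
  injective h -> pm_distinct v -> pm_distinct (v \o h).
Proof. by move=> hi dv i j /dv/hi. Qed.

Lemma rank1_intr (k : fieldType) (v : 'cV[int]_g) :
  (rank1 v)%:mx k = v%:mx k *m (v%:mx k)^T.
Proof. by rewrite /rank1 map_mxM map_trmx. Qed.

Lemma restrict_support (k : fieldType) (X : lmodType k) N (c : 'I_N -> k)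
    (x : 'I_N -> X) : \sum_i c i *: x i = 0 -> ~ (forall i, c i = 0) ->
  exists n (h : 'I_n -> 'I_N), [/\ (0 < n <= N)%N, injective h,
    forall i, c (h i) != 0 & \sum_i c (h i) *: x (h i) = 0].
Proof.
move=> rel nc; pose A := [set i | c i != 0].
exists #|A|, (@enum_val _ (mem A)); split.
- apply/andP; split; last by rewrite -[X in (_ <= X)%N]card_ord max_card.
  apply/card_gt0P.
  have [i /eqP ci] : exists i, c i <> 0 by apply/existsNP.
  by exists i; rewrite inE.
- exact: enum_val_inj.
- by move=> i; have := enum_valP i; rewrite inE.
- rewrite -(big_enum_val (fun i => c i *: x i)) /= -[RHS]rel [RHS](bigID (mem A)) /=.
  rewrite [X in _ = _ + X]big1 ?addr0 // => i.
  by rewrite inE negbK => /eqP->; rewrite scale0r.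
Qed.

Lemma relation_rank (k : fieldType) N (v : 'I_N -> 'cV[int]_g) (c : 'I_N -> k) :
  (forall i, c i != 0) -> \sum_i c i *: (rank1 (v i))%:mx k = 0 ->
  (2 * \rank ((fam_mx v)%:mx k) <= N)%N.
Proof.
(* The relation says that the column space of A is totally isotropic for the
   nondegenerate form D. *)
move=> c0 rel; set A := (fam_mx v)%:mx k; pose D := diag_mx (\row_i c i).
have uD : D \in unitmx.
  rewrite unitmxE det_diag unitfE; apply/prodf_neq0 => i _.
  by rewrite mxE.
have AD : A^T *m (D *m A) = 0.
  rewrite -[RHS]rel; apply/matrixP => i j; rewrite summxE !mxE.
  apply: eq_bigr => l _; rewrite mul_diag_mx rank1_intr !mxE big_ord1 !mxE.
  by rewrite mulrCA.
have := mulmx0_rank_max AD; rewrite mxrank_tr.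
by rewrite (eqmxMfull A (_ : row_full D)) ?row_full_unit // mul2n -addnn.
Qed.

End Relations.

Section SmallRelations.
Variables (R : realType) (g : nat) (Q : 'M[R]_g).
Hypothesis pdQ : positive_definite Q.
Hypothesis nD4 : D4_free Q.

Local Notation rv := (@realify R g 1).
Local Notation Min := (Min Q).

(** An independent family inside a span of rank at most 4 has at most four members, and for these
    [coords_int] is saturation. *)
Lemma span_system r (e : 'I_r -> 'cV[int]_g) : (r <= 4)%N ->
  (forall i, Min (e i)) -> indep R e ->
  unimodular_system (fun x : 'rV[int]_g => Min x^T /\ in_span R e x^T).
Proof.
move=> r4 Me fe; split=> [x [Mx [a xE]]|n A AS Af].
  split; first by rewrite linearN; apply: MinN.
  exists (fun i => - a i); rewrite linearN map_mxN xE -sumrN.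
  by apply: eq_bigr => i _; rewrite scaleNr.
pose w i := (row i A)^T.
have wA : fam_mx w = A by apply/row_matrixP => i; rewrite rowK trmxK.
have fw : indep R w by rewrite /indep wA zfree_row_free.
have n4 : (n <= 4)%N.
  apply: leq_trans r4; have /eqP <- := fw; have /eqP <- := fe.
  apply: mxrankS; apply/row_subP => i.
  rewrite -map_row rowK; apply/in_span_sub.
  by have [_] := AS i.
move=> z y s z0 e0.
have yE : rv y^T = \sum_i (s 0 i)%:~R / z%:~R *: rv (w i).
  have zR : z%:~R != 0 :> R by rewrite intr_eq0.
  apply: (scalemx_inj zR); rewrite -rvZ -trmxZ e0 -[in LHS]wA.
  rewrite mulmx_sum_row linear_sum rv_sum scaler_sumr.
  apply: eq_bigr => i _; rewrite /= trmxZ rvZ rowK trmxK scalerA mulrCA mulfV //.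
  by rewrite mulr1.
have ai := coords_int pdQ nD4 n4 (fun i => (AS i).1) fw yE.
have /choice[m mE] : forall i, exists m : int, (s 0 i)%:~R / z%:~R = m%:~R :> R.
  by move=> i; apply/intrP.
exists (\row_i m i); apply/rowP => i; rewrite !mxE; apply: (@intr_inj R).
by rewrite intrM -mE mulrCA mulfV ?mulr1 // intr_eq0.
Qed.

Lemma relation_span4 (k : fieldType) r (e : 'I_r -> 'cV[int]_g)
    N (v : 'I_N -> 'cV[int]_g) (c : 'I_N -> k) : (r <= 4)%N ->
  (forall i, Min (e i)) -> indep R e -> (forall j, Min (v j)) ->
  (forall j, in_span R e (v j)) -> pm_distinct v ->
  \sum_i c i *: (rank1 (v i))%:mx k = 0 -> forall i, c i = 0.
Proof.
move=> r4 Me fe Mv ve dv rel i.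
(* The vectors are distinct up to sign, so each class is a singleton. *)
have <- : csum (fun j => (v j)^T) c (v i)^T = c i.
  rewrite /csum (big_pred1 i) // => j /=.
  rewrite /eqpm -trmxN; move: (inj_eq (@trmx_inj int g 1)) => E; rewrite !E.
  apply/orP/eqP => [[]/eqP e0|->]; [by apply: dv; left|by apply: dv; right|by left].
apply: (unimodular_relation (span_system r4 Me fe)) => [j||].
- by rewrite trmxK; split.
- rewrite -[RHS]rel; apply: eq_bigr => j _.
  by rewrite rank1_intr !map_trmx trmxK.
- by rewrite -trmx0 (inj_eq trmx_inj) (Min_neq0 (Mv i)).
Qed.

(* If b_j is the coefficient of e_j in w, then x has coordinate 1/(2 b_j) at w in
   the basis where w replaces e_j, while its coordinate at v is still 1/2; so all
   of them are in 1/2 + Z. *)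
Lemma half_sum_span (e : 'I_4 -> 'cV[int]_g) (v w x : 'cV[int]_g) :
  (forall i, Min (e i)) -> indep R e -> Min v -> Min w -> ~ in_span R e v ->
  rv x = 2^-1 *: rv v + \sum_i 2^-1 *: rv (e i) -> in_span R e w ->
  exists i, w = e i \/ w = - e i.
Proof.
move=> Me fe Mv Mw nv xE [b wE].
have bint := coords_int pdQ nD4 (leqnn 4) Me fe wE.
pose E (i : 'I_5) := if unlift ord0 i is Some j then e j else v.
have fE : indep R E := indep_cons fe nv.
have key j : b j != 0 -> (b j = 1 \/ b j = -1) /\ forall i, i != j ->
    b i / (b j + b j) \is a Num.int.
  move=> bj.
  pose b' (i : 'I_5) := if unlift ord0 i is Some l then b l else 0.
  pose E' (i : 'I_5) := if i == lift ord0 j then w else E i.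
  have fE' : indep R E'.
    apply: (indep_exchange (b := b') fE); last by rewrite /b' liftK.
    rewrite big_ord_recl /b' unlift_none scale0r add0r wE.
    by apply: eq_bigr => i _; rewrite /E !liftK.
  have ME' i : Min (E' i).
    by rewrite /E' /E; case: ifP => // _; case: unliftP.
  pose a (i : 'I_5) := if unlift ord0 i is Some l then
    (if l == j then (b j + b j)^-1 else 2^-1 - b l / (b j + b j)) else 2^-1 : R.
  have bj2 : b j + b j != 0 by rewrite -mulr2n mulrn_eq0.
  have xE' : rv x = \sum_i a i *: rv (E' i).
    rewrite big_ord_recl /a /E' unlift_none /= /E unlift_none xE; congr (_ + _).
    under [RHS]eq_bigr do rewrite liftK (inj_eq lift_inj).
    rewrite [RHS](bigD1 j) //= !eqxx [rv w]wE scaler_sumr [X in X + _](bigD1 j) //=.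
    rewrite [LHS](bigD1 j) //= -addrA; congr (_ + _).
      by rewrite scalerA; congr (_ *: _); field; move: bj bj2; rewrite -mulr2n -mulr_natl.
    rewrite -big_split /=; apply: eq_bigr => i /negPf ij; rewrite ij.
    rewrite scalerA -scalerDl; congr (_ *: _); ring.
  have ha : forall i, a i - 2^-1 \is a Num.int.
    have [ai|//] := coords5 pdQ nD4 ME' fE' xE'.
    by have := ai ord0; rewrite /a unlift_none (negPf (half_nint R)).
  split=> [|i ij].
    have := ha (lift ord0 j); rewrite /a liftK eqxx => /intrP[m mE].
    have /intrP[z zE] := bint j.
    have e1 : z * (2 * m + 1) = 1.
      apply: (@intr_inj R); rewrite intrM intrD intrM -zE -mE.
      by field; move: bj bj2; rewrite -mulr2n -mulr_natl.
    have : (z %| z * (2 * m + 1))%Z by rewrite dvdz_mulr.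
    rewrite e1 dvdz1 zE => z1; have [->|->] : z = 1 \/ z = -1 by lia.
      by left.
    by right.
  have := ha (lift ord0 i); rewrite /a liftK (negPf ij) addrAC subrr add0r.
  by rewrite rpredN.
have [j bj] : exists j, b j != 0.
  apply: contrapT => no; have := Min_neq0 Mw; rewrite -(rv_eq0 R) [rv w]wE big1 ?eqxx //.
  move=> i _; have [->|bi] := eqVneq (b i) 0; first by rewrite scale0r.
  by case: no; exists i.
have [bj1 bi0] := key j bj; exists j.
(* A second nonzero coefficient would also be 1 or -1 by [key], and b_i / (2 b_j) would be 1/2 or
   -1/2 instead of an integer. *)
have b0 i : i != j -> b i = 0.
  move=> ij; apply: contrapT => /eqP bi; have [bi1 _] := key i bi.
  have /intrP[m] := bi0 i ij.
  have [->|->] : b i / (b j + b j) = 2^-1 \/ b i / (b j + b j) = - 2^-1.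
    by case: bi1 => ->; case: bj1 => ->; [left|right|right|left]; field.
  - move=> e1; have : (m + m)%:~R = 1 :> R by rewrite intrD -e1; lra.
    by rewrite -[1]/(1%:~R) => /intr_inj; lia.
  - move=> e1; have : (m + m)%:~R = -1 :> R by rewrite intrD -e1; lra.
    by rewrite -[-1]/((-1)%:~R) => /intr_inj; lia.
have {}wE : rv w = b j *: rv (e j).
  by rewrite [LHS]wE (bigD1 j) //= big1 ?addr0 // => i /b0->; rewrite scale0r.
case: bj1 => bj1; [left|right]; apply: (@rv_inj R); rewrite wE bj1 ?scale1r //.
by rewrite scaleN1r rvN.
Qed.

End SmallRelations.

(** * Short relations modulo a prime and over the reals *)

Section Circuits.
Variables (R : realType) (g : nat) (Q : 'M[R]_g).
Hypothesis pdQ : positive_definite Q.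
Hypothesis nD4 : D4_free Q.

Local Notation rv := (@realify R g 1).
Local Notation q v := (qform Q (rv v)).
Local Notation Min := (Min Q).

(** Five half odd integers have squares adding up to at least 5/4, so the value 1 is left to
    integral coordinates with a single entry 1 or -1. *)
Lemma half_int_norm (b : 'I_5 -> R) :
  (forall i, b i \is a Num.int) \/ (forall i, b i - 2^-1 \is a Num.int) ->
  (exists i, b i != 0) -> 1 <= \sum_i b i * b i /\
  (\sum_i b i * b i = 1 -> exists i, (b i = 1 \/ b i = -1) /\
    forall j, j != i -> b j = 0).
Proof.
have b2 i : 0 <= b i * b i by rewrite -expr2 sqr_ge0.
case=> [bi|bh] [i bi0].
  have /intrP[m mE] := bi i.
  have m0 : m != 0 by apply: contraNneq bi0 => m0; rewrite mE m0.
  have bi1 : 1 <= b i * b i by rewrite mE -intrM (ler_int R 1); nia.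
  have rest : 0 <= \sum_(j < 5 | j != i) b j * b j by apply: sumr_ge0.
  rewrite (bigD1 i) //=; split=> [|s1]; first lra.
  exists i; split=> [|j ji].
    have : (b i) ^+ 2 == 1 by rewrite expr2; apply/eqP; lra.
    by rewrite sqrf_eq1 => /orP[]/eqP; [left|right].
  have r0 : \sum_(j < 5 | j != i) b j * b j = 0 by lra.
  by have /eqP := psumr_eq0P (fun j _ => b2 j) r0 ji; rewrite mulf_eq0 orbb => /eqP.
have h4 j : 4^-1 <= b j * b j.
  have /intrP[m mE] := bh j; have -> : b j = m%:~R + 2^-1 by lra.
  have : 0 <= (m * (m + 1))%:~R :> R by rewrite (ler_int R 0); nia.
  by rewrite intrM intrD; lra.
have : \sum_(j < 5) 4^-1 <= \sum_j b j * b j by apply: ler_sum.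
by rewrite sumr_const card_ord; split=> [|h]; lra.
Qed.

(** Lifting the dependence modulo p gives the lattice vector (v - sum a_i e_i) / p, whose coordinate
    1/p at v is not integral. This contradicts [coords_int] when r + 1 <= 4 and leaves the half
    integral case of [coords5]. *)
Lemma modp_span p r (e : 'I_r -> 'cV[int]_g) v :
  prime p -> (r <= 4)%N -> (forall i, Min (e i)) -> Min v -> indep R e ->
  in_span 'F_p e v -> ~ in_span R e v ->
  r = 4%N /\ exists x, rv x = 2^-1 *: rv v + \sum_i 2^-1 *: rv (e i).
Proof.
move=> pp r4 Me Mv feR [a aE] nj.
have pR : p%:R != 0 :> R by rewrite pnatr_eq0 -lt0n prime_gt0.
have [x xE] : exists x, v - \sum_i (a i : nat)%:Z *: e i = p%:Z *: x.
  apply: eq0_modp => //; rewrite map_mxB aE raddf_sum -sumrB big1 // => i _ /=.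
  by rewrite map_mxZ /= -pmulrn natr_Zp subrr.
pose b (i : 'I_r.+1) : R :=
  if unlift ord0 i is Some l then - (a l)%:R / p%:R else p%:R^-1.
pose E (i : 'I_r.+1) := if unlift ord0 i is Some l then e l else v.
have fE : indep R E := indep_cons feR nj.
have ME i : Min (E i) by rewrite /E; case: unliftP.
have xb : rv x = \sum_i b i *: rv (E i).
  apply: (scalemx_inj pR) => /=.
  have -> : p%:R *: rv x = rv (v - \sum_i (a i : nat)%:Z *: e i).
    by rewrite xE rvZ.
  rewrite rvB rv_sum big_ord_recl /b /E unlift_none scalerDr scalerA mulfV // scale1r.
  rewrite scaler_sumr -sumrN; congr (_ + _); apply: eq_bigr => i _.
  by rewrite liftK scalerA mulrCA mulfV // mulr1 rvZ scaleNr.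
have p2 := prime_gt1 pp.
have np : (p%:R^-1 : R) \isn't a Num.int.
  apply/negP => /intrP[m mE]; have : (m * p%:Z)%:~R = 1 :> R.
    by rewrite intrM -mE mulVf.
  rewrite -[1]/(1%:~R) => /intr_inj e1; have : (p%:Z %| m * p%:Z)%Z by rewrite dvdz_mull.
  by rewrite e1 dvdz1; lia.
have r4' : r = 4%N.
  apply/eqP; rewrite eqn_leq r4 ltnNge; apply/negP => r3.
  have r3' : (r.+1 <= 4)%N by [].
  have := coords_int pdQ nD4 r3' ME fE xb ord0.
  by rewrite /b unlift_none (negPf np).
split=> //; subst r.
have [ai|ha] := coords5 pdQ nD4 ME fE xb.
  by have := ai ord0; rewrite /b unlift_none (negPf np).
have [y yE] := half_vector xb ha; exists y.
rewrite yE big_ord_recl /E unlift_none; congr (_ + _).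
by apply: eq_bigr => i _; rewrite liftK.
Qed.

Lemma modp_relation p N (v : 'I_N -> 'cV[int]_g) (c : 'I_N -> 'F_p) :
  prime p -> (N <= 9)%N -> (forall i, Min (v i)) -> pm_distinct v ->
  \sum_i c i *: (rank1 (v i))%:mx 'F_p = 0 -> forall i, c i = 0.
Proof.
move=> pp; move: N v c => N0 v0 c0 N9 Mv0 dv0 rel0; apply: contrapT => nc.
have [N [h [/andP[N_gt0 NN] hi hc rel]]] := restrict_support rel0 nc.
have {N9 NN} N9 : (N <= 9)%N := leq_trans NN N9.
pose v := v0 \o h; pose c := c0 \o h.
have Mv i : Min (v i) by apply: Mv0.
have dv : pm_distinct v by apply: pm_distinct_comp.
have {}rel : \sum_i c i *: (rank1 (v i))%:mx 'F_p = 0 by [].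
have N2 := relation_rank hc rel.
have [r [f [rE fi fe vs]]] := indep_basis 'F_p v.
rewrite -[\rank _]rE in N2; clear rE; pose e := v \o f.
have r4 : (r <= 4)%N by lia.
have Me i : Min (e i) by apply: Mv.
have feR : indep R e := indep_intr R fe.
have [span|nspan] := pselect (forall j, in_span R e (v j)).
  have c00 := relation_span4 pdQ nD4 r4 Me feR Mv span dv rel.
  by case/eqP: (hc (Ordinal N_gt0)); apply: c00.
have [j0 nj0] : exists j, ~ in_span R e (v j) by apply/existsNP.
have dich j := modp_span pp r4 Me (Mv j) feR (vs j).
have [r4' [x0 x0E]] := dich j0 nj0; subst r.
(* The v_j fit into five places: the real span of e contains only the [e i], and at most one vector
   lies outside. But 2 r <= N with r = 4 asks for N >= 8. *)
have /choice[phi phiE] : forall j, exists o : option 'I_4,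
    j = if o is Some i then f i else j0.
  move=> j; have [sj|/dich[_ [x xE]]] := pselect (in_span R e (v j)).
    have [i vi] := half_sum_span pdQ nD4 Me feR (Mv j0) (Mv j) nj0 x0E sj.
    by exists (Some i); apply: dv.
  (* For two vectors outside the span, the difference of the two lattice half sums has coordinates
     1/2 and -1/2 on two independent minimal vectors. *)
  exists None; apply/eqP/negPn/negP => jj0.
  have f1 : indep R (fun _ : 'I_1 => v j).
    apply/indepP => a; rewrite big_ord1 => /eqP.
    rewrite scaler_eq0 -rvE rv_eq0 (negPf (Min_neq0 (Mv j))) orbF => /eqP a0 i.
    by rewrite [i]ord1.
  have f2 : ~ in_span R (fun _ : 'I_1 => v j) (v j0).
    apply: (Min_indep2 pdQ) => //; apply: contraNneq jj0 => e0; apply/eqP/dv.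
      by left.
    by right.
  pose w (i : 'I_2) := if unlift ord0 i is Some l then v j else v j0.
  pose b (i : 'I_2) : R := if unlift ord0 i is Some l then 2^-1 else - 2^-1.
  have Mw i : Min (w i) by rewrite /w; case: unliftP.
  have xb : rv (x - x0) = \sum_i b i *: rv (w i).
    rewrite big_ord_recl big_ord1 /b /w unlift_none liftK rvB x0E xE scaleNr.
    by rewrite opprD addrACA subrr addr0 addrC.
  have := coords_int pdQ nD4 (isT : (2 <= 4)%N) Mw (indep_cons f1 f2) xb ord0.
  by rewrite /b unlift_none rpredN (negPf (half_nint R)).
have : injective phi by move=> i j ij; rewrite (phiE i) (phiE j) ij.
by move=> /leq_card; rewrite card_option !card_ord; lia.
Qed.

Lemma real_relation N (v : 'I_N -> 'cV[int]_g) (c : 'I_N -> R) :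
  (N <= 11)%N -> (forall i, Min (v i)) -> pm_distinct v ->
  \sum_i c i *: rank1 (rv (v i)) = 0 -> forall i, c i = 0.
Proof.
move: N v c => N0 v0 c0 N11 Mv0 dv0 rel0; apply: contrapT => nc.
have [N [h [/andP[N_gt0 NN] hi hc rel]]] := restrict_support rel0 nc.
have {N11 NN} N11 : (N <= 11)%N := leq_trans NN N11.
pose v := v0 \o h.
have Mv i : Min (v i) by apply: Mv0.
have dv : pm_distinct v by apply: pm_distinct_comp.
wlog [c [hc rel P5]] : {c0 rel0 nc hc rel} / exists c : 'I_N -> R,
    [/\ forall i, c i != 0, \sum_i c i *: rank1 (rv (v i)) = 0 &
    (#|[set i | (0 < c i)%R]| <= 5)%N].
  apply; pose c := c0 \o h.
  have [le5|gt5] := leqP #|[set i | (0 < c i)%R]| 5.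
    by exists c; split; [exact: hc|exact: rel|exact: le5].
  exists (fun i => - c i); split => [i||]; first by rewrite oppr_eq0; apply: hc.
    by under eq_bigr do rewrite scaleNr; rewrite sumrN [X in - X]rel oppr0.
  have := cardsC [set i | (0 < c i)%R]; rewrite card_ord.
  suff -> : ~: [set i | (0 < c i)%R] = [set i | (0 < - c i)%R] by lia.
  by apply/setP => i; rewrite !inE oppr_gt0 -leNgt lt_neqAle (hc i : c i != 0).
set P := [set i | _] in P5.
pose vP (i : 'I_#|P|) := v (enum_val i).
have [r [f [rE fi fe vs]]] := indep_basis R vP.
pose e := vP \o f.
have Me i : Min (e i) by apply: Mv.
have rP : (r <= #|P|)%N by rewrite rE rank_leq_row.
have span j : in_span R e (v j).
  have [jP|jP] := boolP (j \in P).
    by have := vs (enum_rank_in jP j); rewrite /vP enum_rankK_in.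
  (* A linear form z that vanishes on the vectors of P turns the relation into a zero sum of
     nonnegative terms - c_i y_i^2, so it vanishes on every v_i. *)
  apply: contrapT => /separating_vector[z [ez yl]].
  pose y i := ((rv (v i))^T *m z) 0 0.
  have yP i : i \in P -> y i = 0.
    by move=> iP; apply: ez; have := vs (enum_rank_in iP i); rewrite /vP enum_rankK_in.
  have y2 : \sum_i - c i * (y i * y i) = 0.
    have := congr1 (fun X => (z^T *m X *m z) 0 0) rel.
    rewrite mulmx0 mul0mx [RHS]mxE mulmx_sumr mulmx_suml summxE => e0.
    under eq_bigr do rewrite mulNr; rewrite sumrN -[X in - X = _]/(\sum_i _).
    rewrite (_ : \sum_i c i * (y i * y i) = 0) ?oppr0 // -[RHS]e0.
    apply: eq_bigr => i _; rewrite -scalemxAr -scalemxAl mxE; congr (_ * _).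
    rewrite /rank1 mulmxA -[_ *m _ *m z]mulmxA [RHS]mxE big_ord1 /y; congr (_ * _).
    by rewrite -[in RHS](trmxK (rv (v i))) -trmx_mul [RHS]mxE.
  have cy0 i : true -> 0 <= - c i * (y i * y i).
    have [/yP->|] := boolP (i \in P); first by rewrite !mulr0.
    by rewrite inE -leNgt => ci _; rewrite mulr_ge0 ?oppr_ge0 // -expr2 sqr_ge0.
  have /eqP := psumr_eq0P cy0 y2 (isT : (fun=> true) j).
  by rewrite !mulf_eq0 oppr_eq0 (negPf (hc j)) (negPf yl).
have [r4|r5] := leqP r 4.
  have rel' : \sum_i c i *: (rank1 (v i))%:mx R = 0.
    by rewrite -[RHS]rel; apply: eq_bigr => i _; rewrite rank1_intr.
  have := relation_span4 pdQ nD4 r4 Me fe Mv span dv rel'.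
  by move=> /(_ (Ordinal N_gt0))/eqP; rewrite (negPf (hc _)).
have cP : #|P| = 5%N by lia.
have r5' : r = 5%N by lia.
clear rE rP r5; subst r.
have /choice[b bE] := span.
have rel2 i : \sum_j c j * (b j i * b j i) = 0.
  have /row_freeP[B EB] := fe.
  have := congr1 (fun X => (B^T *m X *m B) i i) rel.
  rewrite mulmx0 mul0mx [RHS]mxE mulmx_sumr mulmx_suml summxE => e0.
  rewrite -[RHS]e0; apply: eq_bigr => j _.
  rewrite -scalemxAr -scalemxAl mxE; congr (_ * _).
  have -> : rv (v j) = ((\row_l b j l) *m (fam_mx e)%:mx R)^T.
    by rewrite fam_mxE [LHS]bE; apply: eq_bigr => l _; rewrite mxE.
  rewrite /rank1 trmxK mulmxA -[_ *m _ *m B]mulmxA -[_ *m _ *m B]mulmxA EB mulmx1.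
  by rewrite -trmx_mul -mulmxA EB mulmx1 [RHS]mxE big_ord1 !mxE.
(* Two traces of the relation: for the form with orthonormal basis e, and for Q. *)
have s0 : \sum_j c j * (\sum_i b j i * b j i) = 0.
  under eq_bigr do rewrite mulr_sumr; rewrite exchange_big /=.
  by rewrite big1.
have c0 : \sum_j c j = 0.
  pose j0 := Ordinal N_gt0; have q0 : q (v j0) != 0.
    by rewrite gt_eqF // (q_gt0 pdQ (Min_neq0 (Mv j0))).
  apply: (mulIf q0); rewrite mul0r.
  have := congr1 (fun X => \tr (Q *m X)) rel.
  rewrite mulmx0 mxtrace0 mulmx_sumr raddf_sum /= => e0; rewrite -[RHS]e0 mulr_suml.
  apply: eq_bigr => j _; rewrite -scalemxAr mxtraceZ (Min_eq (Mv j0) (Mv j)).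
  by rewrite /rank1 mulmxA mxtrace_mulC mulmxA /mxtrace big_ord1.
have inP j : j \in P -> exists i, v j = e i.
  move=> jP; have le5 : (#|{: 'I_(#|P|)}| <= #|{: 'I_5}|)%N by rewrite !card_ord cP.
  have := inj_card_onto fi le5 (enum_rank_in jP j).
  by case/codomP => i ei; exists i; rewrite /e /vP /= -ei enum_rankK_in.
have bn j : 1 <= \sum_i b j i * b j i /\ (\sum_i b j i * b j i = 1 ->
    exists i, v j = e i \/ v j = - e i).
  have nz : exists i, b j i != 0.
    apply: contrapT => no; have := Min_neq0 (Mv j).
    rewrite -(rv_eq0 R) [rv _]bE big1 ?eqxx // => i _.
    have [->|bi] := eqVneq (b j i) 0; first by rewrite scale0r.
    by case: no; exists i.
  have [h1 h2] := half_int_norm (coords5 pdQ nD4 Me fe (bE j)) nz.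
  split=> // /h2[i [bi b0]]; exists i.
  have {}bE : rv (v j) = b j i *: rv (e i).
    by rewrite [LHS]bE (bigD1 i) //= big1 ?addr0 // => l /b0->; rewrite scale0r.
  case: bi => bi; [left|right]; apply: (@rv_inj R); rewrite bE bi ?scale1r //.
  by rewrite scaleN1r rvN.
have Ps j : j \in P -> \sum_i b j i * b j i = 1.
  move=> /inP[i vi].
  have bj l : b j l - (if l == i then 1 else 0) = 0.
    have /indepP := fe; apply: (fun h => h (fun l => b j l - (if l == i then 1 else 0)) _ l).
    under eq_bigr do rewrite scalerBl; rewrite sumrB -bE vi.
    rewrite (bigD1 i) //= eqxx scale1r big1 ?addr0 ?subrr // => m /negPf->.
    by rewrite scale0r.
  rewrite (bigD1 i) //= (subr0_eq (bj i)) eqxx mulr1 big1 ?addr0 // => l /negPf li.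
  by rewrite (subr0_eq (bj l)) li mul0r.
(* In the difference of the two traces the terms on P vanish, and the others are nonnegative since
   the norms are at least 1. Hence all norms are 1, every v_j is some [e i] up to sign and so
   indexed by P, and all coefficients are positive, against [c0]. *)
have cs j : true -> 0 <= - c j * (\sum_i b j i * b j i - 1).
  have [/Ps->|] := boolP (j \in P); first by rewrite subrr mulr0.
  rewrite inE -leNgt => cj _; rewrite mulr_ge0 ?oppr_ge0 // subr_ge0.
  by have [] := bn j.
have cs0 : \sum_j - c j * (\sum_i b j i * b j i - 1) = 0.
  under eq_bigr do rewrite mulrBr mulr1 mulNr.
  by rewrite sumrB !sumrN s0 c0 oppr0 subrr.
have allP j : j \in P.
  have : - c j * (\sum_i b j i * b j i - 1) == 0.
    by apply/eqP; apply: (psumr_eq0P cs cs0).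
  rewrite mulf_eq0 oppr_eq0 (negPf (hc j)) subr_eq0 => /eqP s1.
  have [i vi] := (bn j).2 s1.
  have : j = enum_val (f i) by apply: dv.
  by move=> ->; apply: enum_valP.
have : 0 < \sum_j c j.
  rewrite (bigD1 (Ordinal N_gt0)) //=; apply: ltr_wpDr.
    by apply: sumr_ge0 => j _; have := allP j; rewrite inE => /ltW.
  by have := allP (Ordinal N_gt0); rewrite inE.
by rewrite c0 ltxx.
Qed.

End Circuits.

(** * Bases of the space of symmetric matrices *)

Section SymmetricCoordinates.
Variable g : nat.

Definition symidx := {ij : 'I_g * 'I_g | (ij.1 <= ij.2)%N}.
Definition sympair (t : 'I_#|{: symidx}|) : 'I_g * 'I_g := val (enum_val t).

Lemma sympair_le t : ((sympair t).1 <= (sympair t).2)%N.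
Proof. exact: valP (enum_val t). Qed.

Lemma sympair_inj : injective sympair.
Proof. by move=> s t /val_inj/enum_val_inj. Qed.

Lemma sympairP (i j : 'I_g) : (i <= j)%N -> exists t, sympair t = (i, j).
Proof.
move=> ij; pose s : symidx := exist _ (i, j) ij.
by exists (enum_rank s); rewrite /sympair enum_rankK.
Qed.

Variable K : nzRingType.

Definition symrow (X : 'M[K]_g) : 'rV[K]_#|{: symidx}| :=
  \row_t X (sympair t).1 (sympair t).2.

(** The disjunction, rather than a sum over both positions, keeps a diagonal coordinate from
    counting twice. *)
Definition rowsym (x : 'rV[K]_#|{: symidx}|) : 'M[K]_g :=
  \matrix_(i, j) \sum_t (if (sympair t == (i, j)) || (sympair t == (j, i))
    then x 0 t else 0).

Lemma rowsym_entry x t :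
  rowsym x (sympair t).1 (sympair t).2 = x 0 t.
Proof.
rewrite mxE (bigD1 t) //= -surjective_pairing eqxx /= big1 ?addr0 // => s st.
case: ifP => // /orP[]; first by rewrite (inj_eq sympair_inj) (negPf st).
move=> /eqP e; have := sympair_le s; rewrite e /= => le2.
have E : (sympair t).1 = (sympair t).2.
  by apply/val_inj/anti_leq; rewrite le2 sympair_le.
case/eqP: st; apply: sympair_inj; rewrite e -E.
by rewrite [RHS]surjective_pairing -E.
Qed.

Lemma rowsym_symm x : symmetric_mx (rowsym x).
Proof. by apply/matrixP => i j; rewrite !mxE; apply: eq_bigr => t _; rewrite orbC. Qed.

Lemma symrowK (X : 'M[K]_g) : symmetric_mx X -> rowsym (symrow X) = X.
Proof.
have main (Y Z : 'M[K]_g) : symmetric_mx Y -> symmetric_mx Z ->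
    (forall i j : 'I_g, (i <= j)%N -> Y i j = Z i j) -> Y = Z.
  move=> sY sZ YZ; apply/matrixP => i j; have [/YZ//|/ltnW ji] := leqP i j.
  by rewrite -sY -sZ !mxE YZ.
move=> sX; apply: main => [||i j /sympairP[t tE]]; [exact: rowsym_symm|by []|].
by have := rowsym_entry (symrow X) t; rewrite tE /= => ->; rewrite mxE tE.
Qed.

Lemma rowsymK x : symrow (rowsym x) = x.
Proof. by apply/rowP => t; rewrite mxE rowsym_entry. Qed.

Lemma symrow_sum n (c : 'I_n -> K) X :
  symrow (\sum_i c i *: X i) = \sum_i c i *: symrow (X i).
Proof.
by apply/rowP => t; rewrite !mxE !summxE; apply: eq_bigr => i _; rewrite !mxE.
Qed.

Lemma symmetric_sum n (c : 'I_n -> K) (X : 'I_n -> 'M_g) :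
  (forall i, symmetric_mx (X i)) -> symmetric_mx (\sum_i c i *: X i).
Proof.
move=> sX; rewrite /symmetric_mx linear_sum; apply: eq_bigr => i _ /=.
by rewrite trmxZ sX.
Qed.

Lemma rowsym_sum n (c : 'I_n -> K) x :
  rowsym (\sum_i c i *: x i) = \sum_i c i *: rowsym (x i).
Proof.
rewrite -[RHS]symrowK; last by apply: symmetric_sum => i; apply: rowsym_symm.
by rewrite symrow_sum; under [in RHS]eq_bigr do rewrite rowsymK.
Qed.

End SymmetricCoordinates.

Lemma card_symidx4 : #|{: symidx 4}| = 10%N.
Proof.
rewrite card_sig -sum1_card big_mkcond /=.
rewrite -(pair_big xpredT xpredT (fun i j : 'I_4 => if (i <= j)%N then 1%N else 0%N)) /=.
by rewrite !big_ord_recl !big_ord0.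
Qed.

Section Extension.
Variable g : nat.

Lemma sym_basis_size (K : nzRingType) n (B : seq 'M[K]_g) : size B = n ->
  (forall X, X \in B -> symmetric_mx X) ->
  (forall X : 'M[K]_g, symmetric_mx X ->
     exists! c : 'rV[K]_n, X = \sum_(i < n) c 0 i *: B`_i) -> sym_basis B.
Proof. by move=> <-. Qed.

(** The rows of P, read as symmetric matrices, form the basis; the factor [pid_mx N] says that its
    first members are the [X i]. *)
Lemma sym_basis_extend (K : comUnitRingType) N (X : 'I_N -> 'M[K]_g)
    (P : 'M[K]_#|{: symidx g}|) :
  P \in unitmx -> (N <= #|{: symidx g}|)%N -> (forall i, symmetric_mx (X i)) ->
  \matrix_i symrow (X i) = pid_mx N *m P ->
  exists B, sym_basis B /\ forall i, X i \in B.
Proof.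
move=> uP le sX XP; set n := #|_| in P uP le XP.
pose B := [seq rowsym (row i P) | i <- enum 'I_n].
have sB : size B = n by rewrite size_map size_enum_ord.
have BE (i : 'I_n) : B`_i = rowsym (row i P).
  by rewrite (nth_map i) ?size_enum_ord // nth_ord_enum.
exists B; split=> [|i].
  apply: (sym_basis_size sB) => [_ /mapP[i _ ->]|Y sY]; first exact: rowsym_symm.
  have sumE (c : 'rV_n) : \sum_(i < n) c 0 i *: B`_i = rowsym (c *m P).
    by rewrite mulmx_sum_row rowsym_sum; apply: eq_bigr => i _; rewrite BE.
  exists (symrow Y *m invmx P); split=> [|c].
    by rewrite sumE mulmxKV // symrowK.
  by rewrite sumE => ->; rewrite rowsymK mulmxK.
apply/mapP; exists (widen_ord le i); first by rewrite mem_enum.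
have := congr1 (fun A => row i A) XP; rewrite rowK row_mul.
rewrite (_ : row i (pid_mx N) = delta_mx 0 (widen_ord le i)) -?rowE => [<-|].
  by rewrite symrowK.
apply/rowP => j; rewrite !mxE eqxx ltn_ord andbT -val_eqE /= eq_sym.
by case: eqP.
Qed.

Lemma rank1_symm (K : comNzRingType) (v : 'cV[K]_g) : symmetric_mx (rank1 v).
Proof. by rewrite /symmetric_mx /rank1 trmx_mul trmxK. Qed.

Lemma symrow_map (K : fieldType) (X : 'M[int]_g) : (symrow X)%:mx K = symrow (X%:mx K).
Proof. by apply/rowP => t; rewrite !mxE. Qed.

Lemma rank1_row_free (k : fieldType) N (v : 'I_N -> 'cV[int]_g) :
  (forall c : 'I_N -> k, \sum_i c i *: (rank1 (v i))%:mx k = 0 -> forall i, c i = 0) ->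
  row_free ((\matrix_i symrow (rank1 (v i)))%:mx k).
Proof.
move=> ind; apply/inj_row_free => z; rewrite mulmx_sum_row => z0.
apply/rowP => i; rewrite mxE; apply: (ind (fun i => z 0 i)).
rewrite -[LHS]symrowK; last first.
  by apply: symmetric_sum => j; rewrite rank1_intr; apply: rank1_symm.
rewrite symrow_sum -(_ : \sum_i z 0 i *: row i ((\matrix_i symrow (rank1 (v i)))%:mx k) = \sum_i _).
  rewrite z0; apply/matrixP => a b; rewrite !mxE big1 // => t _.
  by rewrite mxE if_same.
by apply: eq_bigr => j _; rewrite -map_row rowK symrow_map.
Qed.

Lemma int_basis N (v : 'I_N -> 'cV[int]_g) :
  (forall p, prime p -> forall c : 'I_N -> 'F_p,
    \sum_i c i *: (rank1 (v i))%:mx 'F_p = 0 -> forall i, c i = 0) ->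
  exists B, sym_basis B /\ forall i, rank1 (v i) \in B.
Proof.
move=> ind; have [|le [P uP eP]] := @saturated_completion _ _ (\matrix_i symrow (rank1 (v i))).
  by apply: row_free_saturated => p pp; apply/rank1_row_free/ind.
by apply: (sym_basis_extend uP le) => // i; apply: rank1_symm.
Qed.

(** Independence descends from R to Q because the entries are integers; over a field the bases of
    Gaussian elimination take the place of the Smith form. *)
Lemma rat_basis (R : realType) N (v : 'I_N -> 'cV[int]_g) :
  (forall c : 'I_N -> R, \sum_i c i *: (rank1 (v i))%:mx R = 0 -> forall i, c i = 0) ->
  exists B, sym_basis B /\ forall i, (rank1 (v i))%:mx rat \in B.
Proof.
move=> /rank1_row_free; set A := \matrix_i _ => fA.
have {}fA : row_free (A%:mx rat).
  rewrite -(row_free_map (ratr : rat -> R)) -map_mx_comp.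
  rewrite (_ : map_mx _ A = A%:mx R) //; apply/matrixP => i j.
  by rewrite !mxE /= ratr_int.
have /eqP rA := fA; have le := rank_leq_col (A%:mx rat); rewrite rA in le.
have [L uL LE] := unitmx_pid le (col_ebase_unit (A%:mx rat)).
apply: (@sym_basis_extend _ _ _ (L *m row_ebase (A%:mx rat))) => //.
- by rewrite unitmx_mul uL row_ebase_unit.
- by move=> i; rewrite rank1_intr; apply: rank1_symm.
- have AE := mulmx_ebase (A%:mx rat); rewrite rA in AE.
  rewrite mulmxA -LE AE; apply/row_matrixP => i.
  by rewrite rowK -map_row rowK symrow_map.
Qed.

End Extension.

Local Open Scope classical_set_scope.

(** * Hulls, faces and integral generators *)

Section Hull.
Variables (R : realType) (m n : nat).
Implicit Types S C : set 'M[R]_(m, n).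

Lemma cone_hull_sub S X : S X -> cone_hull S X.
Proof.
move=> SX; exists 1%N, (fun=> 1), (fun=> X); split=> //.
by rewrite big_ord1 scale1r.
Qed.

Lemma linear_hull_sub C X : C X -> X \in linear_hull C.
Proof. by have [h _] := linear_hullP C; apply: h. Qed.

Lemma dim_ge_indep C N (X : 'I_N -> 'M[R]_(m, n)) :
  (forall i, X i \in linear_hull C) ->
  (forall c : 'I_N -> R, \sum_i c i *: X i = 0 -> forall i, c i = 0) ->
  (N <= cone_dim C)%N.
Proof.
move=> XC ind; pose s := [tuple X i | i < N].
have fs : free s.
  apply/freeP => k k0 i; apply: (ind k); rewrite -[RHS]k0.
  by apply: eq_bigr => j _; rewrite (nth_map j) ?size_enum_ord // nth_ord_enum.
have := fs; rewrite /free size_tuple => /eqP <-; apply: dimvS.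
by apply/span_subvP => _ /mapP[i _ ->].
Qed.

Lemma dim_cone_hull_le S (U : {vspace 'M[R]_(m, n)}) :
  (forall X, S X -> X \in U) -> (cone_dim (cone_hull S) <= \dim U)%N.
Proof.
move=> SU; apply: dimvS; have [_ h] := linear_hullP (cone_hull S).
apply: h => _ [k [c [Y [_ SY ->]]]]; apply: memv_suml => i _.
by rewrite memvZ // SU.
Qed.

Lemma cone_hull_image m' n' (f : 'M[R]_(m, n) -> 'M[R]_(m', n')) S :
  (forall k (c : 'I_k -> R) Y, f (\sum_i c i *: Y i) = \sum_i c i *: f (Y i)) ->
  [set f X | X in cone_hull S] = cone_hull [set f X | X in S].
Proof.
move=> fl; apply/seteqP; split=> [_ [_ [k [c [Y [c0 SY ->]]]] <-]|].
  exists k, c, (f \o Y); by split=> // i; exists (Y i).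
move=> _ [k [c [Y [c0 SY ->]]]].
have /choice[Z ZP] : forall i, exists Z, S Z /\ f Z = Y i.
  by move=> i; have [Z] := SY i; exists Z.
exists (\sum_i c i *: Z i); last first.
  by rewrite (fl k c Z); apply: eq_bigr => i _; rewrite (ZP i).2.
by exists k, c, Z; split=> // i; apply: (ZP i).1.
Qed.

End Hull.

Section Generators.
Variables (R : realType) (g : nat).

Definition content1 (X : 'M[int]_g) : Prop :=
  \big[gcdn/0%N]_(i < g) \big[gcdn/0%N]_(j < g) `|X i j|%N = 1%N.

Lemma prime_factor (d : nat) : d != 1%N -> exists2 p, prime p & (p %| d)%N.
Proof.
case: d => [|[|d]] // _; first by exists 2.
by exists (pdiv d.+2); [apply: pdiv_prime|apply: pdiv_dvd].
Qed.

Lemma content1P (X : 'M[int]_g) :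
  content1 X <-> forall p : nat, prime p -> ~ forall i j, (p %| `|X i j|)%N.
Proof.
split=> [c1 p pp pX|h].
  have : (p %| 1)%N.
    rewrite -[X in (_ %| X)%N]c1.
    by apply/dvdn_biggcdP => i _; apply/dvdn_biggcdP => j _.
  by rewrite dvdn1 => /eqP p1; rewrite p1 in pp.
apply/eqP/negPn/negP => /prime_factor[p pp pd]; apply: (h p pp) => i j.
by apply: dvdn_trans pd _; apply/(biggcdn_inf i)/(biggcdn_inf j).
Qed.

Lemma content1_dvd (X : 'M[int]_g) (d : nat) : content1 X ->
  (forall i j, (d %| `|X i j|)%N) -> d = 1%N.
Proof.
move=> /content1P h dX; apply/eqP/negPn/negP => /prime_factor[p pp pd].
by apply: (h p pp) => i j; apply: dvdn_trans pd _.
Qed.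

Lemma content1_neq0 (X : 'M[int]_g) : content1 X -> exists i j, X i j != 0.
Proof.
move=> /content1P h; apply: contrapT => no; apply: (h 2) => // i j.
have -> : X i j = 0 by apply/eqP/negPn/negP => Xij; apply: no; exists i, j.
by [].
Qed.

(** At a place where X is nonzero, write the ratio of absolute values of the entries in lowest terms
    y / x: then x divides every entry of X and y every entry of Y, so both are 1. The sign is
    settled by [0 <= a]. *)
Lemma content1_proportional (X Y : 'M[int]_g) (a : R) : content1 X -> content1 Y ->
  0 <= a -> realify R Y = a *: realify R X -> Y = X.
Proof.
move=> cX cY a0 /matrixP YX.
have [i0 [j0 X0]] := content1_neq0 cX.
have E i j : X i0 j0 * Y i j = Y i0 j0 * X i j.
  apply: (@intr_inj R); have := YX i j; have := YX i0 j0.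
  by rewrite !mxE !intrM => -> ->; ring.
pose h := gcdn `|Y i0 j0| `|X i0 j0|.
have h0 : (0 < h)%N by rewrite gcdn_gt0 orbC absz_gt0 X0.
have /dvdnP[x xE] : (h %| `|X i0 j0|)%N by apply: dvdn_gcdr.
have /dvdnP[y yE] : (h %| `|Y i0 j0|)%N by apply: dvdn_gcdl.
have cop : coprime x y.
  rewrite /coprime -(eqn_pmul2r h0) muln_gcdl mul1n -xE -yE gcdnC.
  exact: eqxx.
have En i j : (x * `|Y i j| = y * `|X i j|)%N.
  apply/eqP; rewrite -(eqn_pmul2r h0) mulnAC -xE mulnAC -yE -!abszM.
  by rewrite E.
have x1 : x = 1%N.
  apply: (content1_dvd cX) => i j; rewrite -(Gauss_dvdr _ cop) -En.
  exact: dvdn_mulr.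
have y1 : y = 1%N.
  apply: (content1_dvd cY) => i j.
  rewrite coprime_sym in cop; rewrite -(Gauss_dvdr _ cop) En.
  exact: dvdn_mulr.
have XY : Y i0 j0 = X i0 j0 \/ Y i0 j0 = - X i0 j0.
  by move: xE yE; rewrite x1 y1; lia.
have X0R : (X i0 j0)%:~R != 0 :> R by rewrite intr_eq0.
have a1 : a = 1.
  have := YX i0 j0; rewrite !mxE; case: XY => ->; rewrite ?rmorphN /=.
    by rewrite -{1}[_%:~R]mul1r => /(mulIf X0R).
  by rewrite -mulN1r => /(mulIf X0R) am; move: a0; rewrite -am; lra.
apply/matrixP => i j; apply: (@intr_inj R); have := YX i j.
by rewrite a1 !mxE mul1r.
Qed.

Lemma realify_rank1 (v : 'cV[int]_g) : realify R (rank1 v) = rank1 (realify R v).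
Proof. by rewrite /rank1 /realify map_mxM map_trmx. Qed.

Definition rank1_cone (T : set 'cV[int]_g) : set 'M[R]_g :=
  cone_hull [set realify R (rank1 v) | v in T].

(** A term with nonzero coefficient in a decomposition of X lies in the face F, hence on the ray of
    X, and primitive matrices on one ray are equal. *)
Lemma integral_generator_rank1 (T : set 'cV[int]_g) X :
  (forall v, T v -> content1 (rank1 v)) ->
  integral_generator (rank1_cone T) X -> exists2 v, T v & X = rank1 v.
Proof.
move=> cT [_ cX [F [[l [l0 FE]] _ FX]]].
have : F (realify R X) by rewrite FX; apply: cone_hull_sub.
rewrite {1}FE => -[[k [c [Y [c0 TY XE]]]] lX].
have [i0 ci0] : exists i, c i != 0.
  apply: contrapT => no; have [i [j /eqP Xij]] := content1_neq0 cX.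
  apply: Xij; apply: (@intr_inj R).
  have := congr1 (fun Z : 'M_g => Z i j) XE; rewrite mxE => ->.
  rewrite big1 ?mxE // => s _; have [->|cs] := eqVneq (c s) 0; first by rewrite scale0r.
  by case: no; exists s.
have CY i : rank1_cone T (Y i) by apply: cone_hull_sub.
have lY : l (Y i0) = 0.
  have s0 : \sum_i c i * l (Y i) = 0.
    transitivity (l (realify R X)) => //.
    by rewrite XE linear_sum; apply: eq_bigr => i _; rewrite linearZ.
  have pos i : true -> 0 <= c i * l (Y i) by rewrite mulr_ge0 // l0.
  have : c i0 * l (Y i0) == 0 by apply/eqP; apply: (psumr_eq0P pos s0).
  by rewrite mulf_eq0 (negPf ci0) => /eqP.
have : F (Y i0) by rewrite FE.
rewrite FX => -[k' [c' [Z [c'0 ZX YE]]]].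
have [v Tv vY] := TY i0; exists v => //.
apply/esym; apply: (@content1_proportional _ _ (\sum_i c' i)) => //.
- exact: cT.
- exact: sumr_ge0.
- rewrite vY YE scaler_suml; apply: eq_bigr => i _.
  by rewrite (ZX i).
Qed.

Lemma rank1_integral_generator (T : set 'cV[int]_g) w :
  T w -> w != 0 -> content1 (rank1 w) -> integral_generator (rank1_cone T) (rank1 w).
Proof.
move=> Tw w0 cw; split=> //; first exact: rank1_symm.
pose x := realify R w; pose n2 (y : 'cV[R]_g) : R := (y^T *m y) 0 0.
have n2E y : n2 y = \sum_i y i 0 ^+ 2.
  by rewrite /n2 mxE; apply: eq_bigr => i _; rewrite mxE expr2.
have n2_ge0 y : 0 <= n2 y by rewrite n2E sumr_ge0 // => i _; apply: sqr_ge0.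
have n2_eq0 y : n2 y = 0 -> y = 0.
  rewrite n2E => y0; apply/colP => i; rewrite mxE.
  have : y i 0 ^+ 2 == 0.
    by apply/eqP; apply: (psumr_eq0P _ y0) => // j _; apply: sqr_ge0.
  by rewrite sqrf_eq0 => /eqP.
have x0 : x != 0.
  apply: contraNneq w0 => x0; apply/eqP/colP => i.
  by have /colP/(_ i) := x0; rewrite !mxE => /eqP; rewrite intr_eq0 => /eqP.
have nx0 : 0 < n2 x.
  by rewrite lt_neqAle n2_ge0 andbT eq_sym; apply: contraNneq x0 => /n2_eq0->.
(* The supporting hyperplane is given by |x|^2 |y|^2 - (x . y)^2, which is
   nonnegative, and zero only for y proportional to x. *)
pose A := n2 x *: 1%:M - rank1 x.
pose l : {scalar 'M[R]_g} := (mxtrace \o mulmx A).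
have lE y : l (rank1 y) = n2 x * n2 y - (x^T *m y) 0 0 ^+ 2.
  rewrite /l /= /A mulmxBl raddfB /= -scalemxAl mul1mx mxtraceZ; congr (_ * _ - _).
    by rewrite /rank1 mxtrace_mulC /mxtrace big_ord1.
  rewrite /rank1 mulmxA mxtrace_mulC !mulmxA -mulmxA /mxtrace big_ord1 mxE big_ord1.
  by rewrite expr2; congr (_ * _); rewrite -[in RHS](trmxK y) -trmx_mul [RHS]mxE.
(* The defect in the Cauchy-Schwarz inequality as a squared norm: it gives both l >= 0 and, where l
   vanishes, proportionality of y to x. *)
have key y : n2 (n2 x *: y - (x^T *m y) 0 0 *: x) = n2 x * l (rank1 y).
  rewrite lE; set a := n2 x; set b := (x^T *m y) 0 0.
  have b' : (y^T *m x) 0 0 = b.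
    by rewrite /b -[in RHS](trmxK y) -trmx_mul [RHS]mxE.
  have trB (u v : 'cV[R]_g) : (u - v)^T = u^T - v^T.
    by apply/matrixP => i j; rewrite !mxE.
  rewrite {1}/n2 trB !trmxZ mulmxBl !mulmxBr -!scalemxAl -!scalemxAr.
  have eB (u v : 'M[R]_1) : (u - v) 0 0 = u 0 0 - v 0 0 by rewrite !mxE.
  have eZ z (u : 'M[R]_1) : (z *: u) 0 0 = z * u 0 0 by rewrite mxE.
  rewrite !(eB, eZ) -/(n2 x) -/(n2 y) -/a b' -/b; ring.
have lC X : rank1_cone T X -> 0 <= l X.
  move=> [k [c [Y [c0 TY ->]]]]; rewrite linear_sum sumr_ge0 // => i _.
  rewrite linearZ mulr_ge0 //; have [v _ <-] := TY i.
  by rewrite realify_rank1 -(pmulr_rge0 _ nx0) -key.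
exists [set X | rank1_cone T X /\ l X = 0].
have lx : l (realify R (rank1 w)) = 0.
  by rewrite realify_rank1 lE -/(n2 _) -expr2 subrr.
have FE : [set X | rank1_cone T X /\ l X = 0] = cone_hull [set realify R (rank1 w)].
  apply/seteqP; split=> [X [[k [c [Y [c0 TY XE]]]] lX]|X [k [c [Y [c0 wY XE]]]]].
    have s0 : \sum_i c i * l (Y i) = 0.
      transitivity (l X) => //.
      by rewrite XE linear_sum; apply: eq_bigr => i _; rewrite linearZ.
    have pos i : true -> 0 <= c i * l (Y i).
      by move=> _; rewrite mulr_ge0 // lC //; apply: cone_hull_sub.
    have /choice[a aE] : forall i, exists a, 0 <= a /\ c i *: Y i = a *: realify R (rank1 w).
      move=> i; have : c i * l (Y i) == 0 by apply/eqP; apply: (psumr_eq0P pos s0).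
      rewrite mulf_eq0 => /orP[/eqP ->|/eqP lY]; first by exists 0; rewrite !scale0r.
      have [v _ vY] := TY i; have := key (realify R v).
      rewrite -realify_rank1 vY lY mulr0 => /n2_eq0/eqP; rewrite subr_eq0 => /eqP vx.
      pose b := (x^T *m realify R v) 0 0 / n2 x.
      have vE : realify R v = b *: x.
        rewrite /b mulrC -scalerA -vx scalerA mulVf ?scale1r //.
        by rewrite gt_eqF.
      exists (c i * b ^+ 2); rewrite mulr_ge0 ?sqr_ge0 //; split=> //.
      rewrite -vY !realify_rank1 vE /rank1 trmxZ -scalemxAr -scalemxAl !scalerA.
      by rewrite expr2 mulrA.
    exists k, a, (fun=> realify R (rank1 w)); split=> // [i|]; first by have [] := aE i.
    by rewrite XE; apply: eq_bigr => i _; have [] := aE i.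
  split.
    exists k, c, Y; split=> // i; exists w => //.
    by rewrite (wY i).
  rewrite XE linear_sum big1 // => i _.
  by rewrite linearZ /= (wY i) -[X in _ * X]/(l _) lx mulr0.
split; [by exists l|rewrite FE|by rewrite FE].
apply/eqP; rewrite eqn_leq; apply/andP; split.
  apply: leq_trans (dim_cone_hull_le (U := <[realify R (rank1 w)]>%VS) _) _.
    by move=> _ ->; apply: memv_line.
  by rewrite dim_vline; case: eqP.
apply: (dim_ge_indep (X := fun _ : 'I_1 => realify R (rank1 w))) => [i|c].
  by apply/linear_hull_sub/cone_hull_sub.
rewrite big_ord1 => /eqP; rewrite scaler_eq0 => /orP[/eqP c0 i|/eqP w00].
  by rewrite [i]ord1.
have [i [j /eqP[]]] := content1_neq0 cw; apply: (@intr_inj R).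
by have /matrixP/(_ i j) := w00; rewrite !mxE.
Qed.

End Generators.

(** * Basic and simplicial cones in the absence of a D4 quadruple *)

Section D4FreeCones.
Variables (R : realType) (g : nat).

Lemma zero_cone_generator X : ~ integral_generator [set (0 : 'M[R]_g)] X.
Proof.
move=> [_ cX [F [[l [_ FE]] _ FX]]].
have : F (realify R X) by rewrite FX; apply: cone_hull_sub.
rewrite FE => -[/matrixP X0 _]; have [i [j /eqP[]]] := content1_neq0 cX.
by apply: (@intr_inj R); have := X0 i j; rewrite !mxE.
Qed.

Lemma zero_cone_basic : basic [set (0 : 'M[R]_g)].
Proof.
have [|B [sB _]] := @int_basis g 0 (fun=> 0); first by move=> p pp c _ [].
by exists B; split=> // X /zero_cone_generator.
Qed.

Lemma zero_cone_simplicial : simplicial [set (0 : 'M[R]_g)].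
Proof.
have [|B [sB _]] := @rat_basis g R 0 (fun=> 0); first by move=> c _ [].
by exists B; split=> // X /zero_cone_generator.
Qed.

Variable Q : 'M[R]_g.
Hypothesis pdQ : positive_definite Q.

Local Notation rv := (@realify R g 1).
Local Notation q v := (qform Q (rv v)).
Local Notation Min := (Min Q).

(** A prime dividing the diagonal entries, which are squares, divides v, and the quotient would be
    shorter. *)
Lemma Min_content v : Min v -> content1 (rank1 v).
Proof.
move=> Mv; apply/content1P => p pp pv.
have [w vE] : exists w, v = p%:Z *: w.
  exists (\col_i (v i ord0 %/ p%:Z)%Z); apply/colP => i; rewrite !mxE mulrC divzK //.
  have := pv i i; rewrite /rank1 !mxE big_ord1 mxE abszM.
  by rewrite Euclid_dvdM // orbb dvdzE.
have w0 : w != 0 by apply: contraNneq (Min_neq0 Mv) => w0; rewrite vE w0 scaler0.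
have := Min_le Mv w0; rewrite vE rvZ qformE (bformZr Q) (bformC pdQ) (bformZr Q) -qformE.
have qw := q_gt0 pdQ w0.
rewrite mulrA -{2}[q w]mul1r ler_pM2r // -rmorphM /= (ler_int R _ 1).
by have := prime_gt1 pp; nia.
Qed.

Hypothesis nD4 : D4_free Q.

Lemma rank1_hull v : Min v -> rank1 (rv v) \in linear_hull (sigma Q).
Proof.
move=> Mv; apply/linear_hull_sub/cone_hull_sub.
by exists v => //; apply: realify_rank1.
Qed.

(** Up to eleven forms are independent, so at most ten fit into the hull; a longer family would
    contain eleven. *)
Lemma family_indep N (v : 'I_N -> 'cV[int]_g) : (cone_dim (sigma Q) <= 10)%N ->
  (forall i, Min (v i)) -> pm_distinct v -> (N <= cone_dim (sigma Q))%N /\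
  forall c : 'I_N -> R, \sum_i c i *: rank1 (rv (v i)) = 0 -> forall i, c i = 0.
Proof.
move=> d10; have small n (w : 'I_n -> 'cV[int]_g) : (n <= 11)%N ->
    (forall i, Min (w i)) -> pm_distinct w -> (n <= cone_dim (sigma Q))%N /\
    forall c : 'I_n -> R, \sum_i c i *: rank1 (rv (w i)) = 0 -> forall i, c i = 0.
  move=> n11 Mw dw; have ind := fun c => real_relation pdQ nD4 n11 Mw dw (c := c).
  by split=> //; apply: dim_ge_indep ind => i; apply: rank1_hull.
move=> Mv dv; have [N11|N11] := leqP N 11; first exact: small.
have [||] := @small 11 (v \o widen_ord (ltnW N11)) (leqnn _).
- by move=> i; apply: Mv.
- by apply: pm_distinct_comp dv => i j /(congr1 val)/= /val_inj.
- by move=> le11; have := leq_trans le11 d10.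
Qed.

(** The bound on sizes gives a largest family, which exhausts [Min Q] up to sign; finiteness of
    [Min Q] comes out rather than being presupposed. *)
Lemma maximal_family : (cone_dim (sigma Q) <= 10)%N ->
  exists N (v : 'I_N -> 'cV[int]_g), [/\ forall i, Min (v i), pm_distinct v &
    forall w, Min w -> exists i, rank1 w = rank1 (v i)].
Proof.
move=> d10; pose P N := `[< exists v : 'I_N -> 'cV[int]_g,
  (forall i, Min (v i)) /\ pm_distinct v >].
have P0 : exists N, P N.
  by exists 0%N; apply/asboolP; exists (fun=> 0); split=> [[]|[]].
have Pb N : P N -> (N <= 10)%N.
  move=> /asboolP[v [Mv dv]]; have [le _] := family_indep d10 Mv dv.
  exact: leq_trans le d10.
case: (ex_maxnP P0 Pb) => N /asboolP[v [Mv dv]] Nmax.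
exists N, v; split=> // w Mw; apply: contrapT => no.
have new i : ~ (w = v i \/ w = - v i).
  case=> e; apply: no; exists i; rewrite e //.
  by rewrite /rank1 trmxN mulNmx mulmxN opprK.
have := Nmax N.+1; rewrite ltnn => /(_ _)/negP; apply => //.
apply/asboolP; exists (fun i => if unlift ord0 i is Some j then v j else w).
split=> [i|i j]; first by case: unliftP.
case: (unliftP ord0 i) => [i' ->|->]; case: (unliftP ord0 j) => [j' ->|->] //.
- by move=> /dv->.
- by case=> e; case: (new i'); [left|right]; rewrite e ?opprK.
- by move/new.
Qed.

Lemma sigma_basic : (cone_dim (sigma Q) <= 9)%N -> basic (sigma Q).
Proof.
move=> d9; have d10 := leqW d9; have [N [v [Mv dv vP]]] := maximal_family d10.
have [le _] := family_indep d10 Mv dv.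
have [|B [sB vB]] := @int_basis g N v.
  move=> p pp c; apply: (modp_relation pdQ nD4 pp (leq_trans le d9) Mv dv).
exists B; split=> // X /(integral_generator_rank1 Min_content)[w Mw ->].
by have [i ->] := vP w Mw.
Qed.

Lemma sigma_simplicial : (cone_dim (sigma Q) <= 10)%N -> simplicial (sigma Q).
Proof.
move=> d10; have [N [v [Mv dv vP]]] := maximal_family d10.
have [_ ind] := family_indep d10 Mv dv.
have [|B [sB vB]] := @rat_basis g R N v.
  move=> c c0; apply: ind; rewrite -[RHS]c0.
  by apply: eq_bigr => i _; rewrite -realify_rank1.
exists B; split=> // X /(integral_generator_rank1 Min_content)[w Mw ->].
by have [i ->] := vP w Mw; apply: vB.
Qed.

End D4FreeCones.

(** * The cone of D4 *)

Section D4Form.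
Local Notation i0 := (ord0 : 'I_4).
Local Notation i1 := (lift ord0 ord0 : 'I_4).
Local Notation i2 := (lift ord0 (lift ord0 ord0) : 'I_4).
Local Notation i3 := (lift ord0 (lift ord0 (lift ord0 ord0)) : 'I_4).

Lemma sum4 (V : nmodType) (F : 'I_4 -> V) :
  \sum_i F i = F i0 + F i1 + F i2 + F i3.
Proof. by rewrite !big_ord_recl big_ord0 addr0 !addrA. Qed.

Lemma ord4P (P : 'I_4 -> Prop) : P i0 -> P i1 -> P i2 -> P i3 -> forall i, P i.
Proof.
move=> h0 h1 h2 h3 i.
case: (unliftP ord0 i) => [{}i ->|->] //.
case: (unliftP ord0 i) => [{}i ->|->] //.
case: (unliftP ord0 i) => [{}i ->|->] //.
by case: (unliftP ord0 i) => [[]|->].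
Qed.

(** The squared Euclidean norm of [D4_basis *m u]. *)
Definition d4form (K : comNzRingType) (u : 'cV[K]_4) : K :=
  u i0 0 ^+ 2 + (u i1 0 - u i0 0) ^+ 2 + (u i2 0 + u i3 0 - u i1 0) ^+ 2 +
  (u i3 0 - u i2 0) ^+ 2.

Lemma D4_basis_mul (u : 'cV[int]_4) :
  [/\ (D4_basis *m u) i0 0 = u i0 0, (D4_basis *m u) i1 0 = u i1 0 - u i0 0,
      (D4_basis *m u) i2 0 = u i2 0 + u i3 0 - u i1 0 &
      (D4_basis *m u) i3 0 = u i3 0 - u i2 0].
Proof. by split; rewrite mxE sum4 !mxE /=; ring. Qed.

Lemma qform_D4_basis (u : 'cV[int]_4) : qform 1%:M (D4_basis *m u) = d4form u.
Proof.
rewrite /qform mulmx1 mxE sum4 !(mxE trmx_key); have [-> -> -> ->] := D4_basis_mul u.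
by rewrite /d4form !expr2.
Qed.

Lemma sum4_sqr_eq0 (K : realDomainType) (a b c d : K) :
  a ^+ 2 + b ^+ 2 + c ^+ 2 + d ^+ 2 <= 0 -> [/\ a = 0, b = 0, c = 0 & d = 0].
Proof.
have sq (z : K) : 0 <= z ^+ 2 := sqr_ge0 z.
move=> le0; have /eqP : a ^+ 2 + b ^+ 2 + c ^+ 2 + d ^+ 2 = 0.
  by apply/le_anti; rewrite le0 !addr_ge0.
rewrite !paddr_eq0 ?addr_ge0 // !sqrf_eq0 -!andbA.
by case/and4P => /eqP-> /eqP-> /eqP-> /eqP->.
Qed.

(** The form is even, so only the value 0 has to be excluded, and there all four squares vanish. *)
Lemma d4form_ge2 (u : 'cV[int]_4) : u != 0 -> 2 <= d4form u.
Proof.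
move=> u0; rewrite leNgt; apply/negP => lt2.
have E : d4form u = 2 * (u i0 0 ^+ 2 + u i1 0 ^+ 2 + u i2 0 ^+ 2 + u i3 0 ^+ 2
  - u i0 0 * u i1 0 - u i1 0 * u i2 0 - u i1 0 * u i3 0) by rewrite /d4form; ring.
have le0 : d4form u <= 0 by move: lt2; rewrite E; lia.
have [e1 e2 e3 e4] : [/\ u i0 0 = 0, u i1 0 - u i0 0 = 0,
    u i2 0 + u i3 0 - u i1 0 = 0 & u i3 0 - u i2 0 = 0] := sum4_sqr_eq0 le0.
have [z1 z2 z3] : [/\ u i1 0 = 0, u i2 0 = 0 & u i3 0 = 0].
  by clear E le0 lt2; split; lia.
by case/eqP: u0; apply/colP; apply: ord4P; rewrite [RHS]mxE.
Qed.

Lemma D4_coordP (u : 'cV[int]_4) : D4_coordinates u <-> u != 0 /\ d4form u <= 2.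
Proof.
have D4B w : D4 (D4_basis *m w).
  rewrite /D4 /= sum4; have [-> -> -> ->] := D4_basis_mul w.
  by apply/dvdzP; exists (w i3 0); ring.
have Binj (w : 'cV_4) : (D4_basis *m w == 0) = (w == 0).
  apply/eqP/eqP => [w0|->]; last exact: mulmx0.
  have [E0 E1 E2 E3] := D4_basis_mul w.
  have e0 : w i0 0 = 0 by rewrite -E0 w0 mxE.
  have e1 : w i1 0 - w i0 0 = 0 by rewrite -E1 w0 mxE.
  have e2 : w i2 0 + w i3 0 - w i1 0 = 0 by rewrite -E2 w0 mxE.
  have e3 : w i3 0 - w i2 0 = 0 by rewrite -E3 w0 mxE.
  have [z1 z2 z3] : [/\ w i1 0 = 0, w i2 0 = 0 & w i3 0 = 0] by split; lia.
  by apply/colP; apply: ord4P; rewrite [RHS]mxE.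
rewrite /D4_coordinates /minimal_vectors /=; split=> [[_ Bu0 h]|[u0 le2]].
  split; first by rewrite -Binj.
  rewrite -qform_D4_basis; apply: le_trans (h (D4_basis *m delta_mx i0 0) (D4B _) _) _.
    rewrite Binj; apply/eqP => /colP/(_ i0)/eqP; by rewrite !mxE.
  by rewrite qform_D4_basis /d4form !mxE.
split; [exact: D4B|by rewrite Binj|move=> w /D4_basisP[v [-> _]]].
rewrite Binj !qform_D4_basis => /d4form_ge2; exact: le_trans.
Qed.

Section Embedding.
Variables (R : realType) (g : nat) (Q : 'M[R]_g) (F : 'M[int]_(g, 4)) (s : R).
Hypothesis s_gt0 : 0 < s.
Hypothesis FQ : forall u, qform Q (realify R (F *m u)) = s * (d4form u)%:~R.
Hypothesis MinF : forall v, Min Q v -> exists u, v = F *m u.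

Lemma Min_embedding v0 : Min Q v0 ->
  Min Q = [set F *m u | u in D4_coordinates].
Proof.
move=> M0; have [u0 v0E] := MinF M0.
have u0_neq0 : u0 != 0.
  by apply: contraNneq (Min_neq0 M0) => u00; rewrite v0E u00 mulmx0.
have Fu0 (u : 'cV_4) : u != 0 -> F *m u != 0.
  move=> un; apply/eqP => Fu; have := FQ u; rewrite Fu rv0.
  rewrite /qform mulmx0 mxE => /esym/eqP; rewrite mulf_eq0 gt_eqF //= intr_eq0 => /eqP E.
  by have := d4form_ge2 un; rewrite E.
have le (u w : 'cV_4) : (qform Q (realify R (F *m u)) <= qform Q (realify R (F *m w))) =
    (d4form u <= d4form w).
  by rewrite !FQ ler_pM2l // ler_int.
apply/seteqP; split=> [v Mv|_ [u /D4_coordP[un le2] <-]].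
  have [u vE] := MinF Mv; exists u => //; apply/D4_coordP.
  have un : u != 0 by apply: contraNneq (Min_neq0 Mv) => u00; rewrite vE u00 mulmx0.
  split=> //; have d0 : delta_mx i0 0 != 0 :> 'cV[int]_4.
    by apply/eqP => /colP/(_ i0)/eqP; rewrite !mxE.
  have := Min_le Mv (Fu0 _ d0); rewrite vE le => /le_trans; apply.
  by rewrite /d4form !mxE.
apply: (MinP M0 (Fu0 u un)); rewrite v0E le; apply: le_trans le2 _.
exact: d4form_ge2.
Qed.

End Embedding.

End D4Form.

Section Congruence.
Variable R : realType.

Lemma realify_rank1_mul m n (U : 'M[int]_(m, n)) (w : 'cV_n) :
  realify R (rank1 (U *m w)) = realify R U *m realify R (rank1 w) *m (realify R U)^T.
Proof.
have rM n1 n2 n3 (A : 'M[int]_(n1, n2)) (B : 'M_(n2, n3)) :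
  realify R (A *m B) = realify R A *m realify R B by apply: map_mxM.
have rT (A : 'M[int]_(m, n)) : realify R A^T = (realify R A)^T by rewrite /realify map_trmx.
by rewrite -rT -!rM /rank1 trmx_mul !mulmxA.
Qed.

Lemma congruence_rank1_cone m n (U : 'M[int]_(m, n)) (T : set 'cV[int]_n) :
  [set realify R U *m X *m (realify R U)^T | X in @rank1_cone R _ T] =
  @rank1_cone R _ [set U *m w | w in T].
Proof.
rewrite /rank1_cone cone_hull_image; last first.
  move=> k c Y; rewrite mulmx_sumr mulmx_suml; apply: eq_bigr => i _.
  by rewrite -scalemxAr -scalemxAl.
rewrite !image_comp; congr cone_hull; apply: eq_imagel => w _ /=.
by rewrite realify_rank1_mul.
Qed.

Lemma D4_coneE g : @D4_cone R g = @rank1_cone R _ [set pid_mx 4 *m u | u in D4_coordinates].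
Proof. by rewrite /rank1_cone image_comp. Qed.

End Congruence.

(** * A quadruple of minimal vectors with half sum in the lattice generates D4 *)

Section D4Quadruple.
Local Notation i0 := (ord0 : 'I_4).
Local Notation i1 := (lift ord0 ord0 : 'I_4).
Local Notation i2 := (lift ord0 (lift ord0 ord0) : 'I_4).
Local Notation i3 := (lift ord0 (lift ord0 (lift ord0 ord0)) : 'I_4).

Variables (R : realType) (g : nat) (Q : 'M[R]_g).
Hypothesis pdQ : positive_definite Q.

Local Notation rv := (@realify R g 1).
Local Notation q v := (qform Q (rv v)).
Local Notation Min := (Min Q).

(** The total weight is exactly 2, so [q_combination] makes a sum of nonnegative terms vanish. *)
Lemma half_sum_norm (e : 'I_4 -> 'cV[int]_g) x i :
  (forall i, Min (e i)) -> indep R e -> rv x = \sum_i 2^-1 *: rv (e i) ->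
  q (x - e i) = q (e i).
Proof.
move=> Me fe xE; have xe j : x - e j != 0.
  apply/eqP => /eqP; rewrite subr_eq0 => /eqP xej.
  have /indepP := fe => /(_ (fun l => 2^-1 - (if l == j then 1 else 0)) _ j).
  rewrite eqxx => h; have : (2^-1 - 1 : R) = 0.
    apply: h; under eq_bigr do rewrite scalerBl; rewrite sumrB -xE xej.
    rewrite (bigD1 j) //= eqxx scale1r big1 ?addr0 ?subrr // => l /negPf->.
    by rewrite scale0r.
  lra.
have s0 : \sum_j 2^-1 * (q (x - e j) - q (e j)) = 0.
  rewrite (q_combination pdQ xE) sumr_const card_ord -[_ *+ 4]mulr_natl.
  by rewrite (_ : 4%:R / 2 - 2 = 0) ?mul0r //; lra.
have pos j : true -> 0 <= 2^-1 * (q (x - e j) - q (e j)).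
  by move=> _; rewrite mulr_ge0 ?invr_ge0 // subr_ge0 Min_le.
have : 2^-1 * (q (x - e i) - q (e i)) == 0.
  by apply/eqP; apply: (psumr_eq0P pos s0).
by rewrite mulf_eq0 invr_eq0 pnatr_eq0 /= subr_eq0 => /eqP.
Qed.

Variables (e : 'I_4 -> 'cV[int]_g) (x : 'cV[int]_g).
Hypothesis Me : forall i, Min (e i).
Hypothesis fe : indep R e.
Hypothesis xE : rv x = \sum_i 2^-1 *: rv (e i).

Let m := q (e i0).

Let qe i : q (e i) = m. Proof. exact: Min_eq. Qed.

(** The hypotheses are stable under replacing e_i by -e_i and x by x - e_i, so norms found for x
    transfer to half sums with other signs. *)
Let flip i (e' := fun j => if j == i then - e i else e j) :
  [/\ forall j, Min (e' j), indep R e' & rv (x - e i) = \sum_j 2^-1 *: rv (e' j)].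
Proof.
split=> [j||].
- by rewrite /e'; case: ifP => // _; apply: MinN.
- apply: (indep_exchange (b := fun l => if l == i then -1 else 0) fe); last first.
    by rewrite eqxx oppr_eq0 oner_eq0.
  rewrite (bigD1 i) //= eqxx big1 ?addr0 => [|l /negPf->]; last by rewrite scale0r.
  by rewrite scaleN1r map_mxN.
- rewrite rvB xE (bigD1 i) //= [RHS](bigD1 i) //= /e' eqxx rvN scalerN addrAC.
  congr (_ + _); last by apply: eq_bigr => j /negPf->.
  by apply/colP => l; rewrite !mxE; lra.
Qed.

Lemma norm_x : q x = m.
Proof.
have [M' f' x'E] := flip i0; have := half_sum_norm i0 M' f' x'E.
by rewrite eqxx opprK subrK rvN (qformN pdQ).
Qed.

Lemma norm_x_sub i : q (x - e i) = m.
Proof. by rewrite half_sum_norm. Qed.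

Lemma norm_x_sub2 i j : i != j -> q (x - e i - e j) = m.
Proof.
move=> ij; have [M' f' x'E] := flip i; have := half_sum_norm j M' f' x'E.
by rewrite eq_sym (negPf ij) qe.
Qed.

Lemma half_sum_Min : [/\ Min x, forall i, Min (x - e i) &
  forall i j, i != j -> Min (x - e i - e j)].
Proof.
have q0 : 0 < m by apply: q_gt0 => //; apply: Min_neq0.
have M y : q y = m -> Min y.
  move=> qy; apply: (MinP (Me i0)); last by rewrite qy.
  apply/eqP => y0; move: q0; rewrite -qy y0 rv0 /qform mulmx0 mxE.
  by rewrite ltxx.
by split=> *; apply: M; [exact: norm_x|exact: norm_x_sub|exact: norm_x_sub2].
Qed.

(** Polarization of the equal norms of x, x - e_i, x - e_j and x - e_i - e_j. *)
Lemma frame_orth i j : i != j -> bform Q (rv (e i)) (rv (e j)) = 0.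
Proof.
move=> ij; have h1 := norm_x_sub2 ij; have h2 := norm_x_sub i; have h3 := norm_x_sub j.
have h0 := norm_x; move: h1 h2 h3.
rewrite !rvB !(qformB pdQ) !qe h0.
have -> : bform Q (rv x - rv (e i)) (rv (e j)) =
    bform Q (rv x) (rv (e j)) - bform Q (rv (e i)) (rv (e j)).
  by rewrite ![bform Q _ (rv (e j))](bformC pdQ) -scaleN1r bformDr bformZr mulN1r.
lra.
Qed.

Lemma frame_norm (a : 'I_4 -> R) :
  qform Q (\sum_i a i *: rv (e i)) = m * \sum_i a i ^+ 2.
Proof.
rewrite qformE bform_sumr mulr_sumr; apply: eq_bigr => i _.
rewrite (bformC pdQ) bform_sumr (bigD1 i) //= big1 ?addr0 => [|j ji].
  by rewrite -qformE qe; ring.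
by rewrite frame_orth ?mulr0 // eq_sym.
Qed.

(* The images of the simple roots of D4: e0, e1, e2 are the outer ones. *)
Definition D4_embedding : 'M[int]_(g, 4) :=
  \matrix_(i, j) (nth 0 [:: e i0; x - e i0 - e i1 - e i2; e i1; e i2] j) i 0.

Local Notation F := D4_embedding.

Lemma D4_embedding_mul (u : 'cV[int]_4) :
  F *m u = u i0 0 *: e i0 + u i1 0 *: (x - e i0 - e i1 - e i2) +
    u i2 0 *: e i1 + u i3 0 *: e i2.
Proof. by apply/colP => i; rewrite mxE sum4 !mxE /=; ring. Qed.

(** Coordinates of [F *m u] in the frame e, where the central root is (- e_0 - e_1 - e_2 + e_3) /
    2. *)
Let frame_coord (u : 'cV[int]_4) (i : 'I_4) : R :=
  nth 0 [:: (u i0 0)%:~R - (u i1 0)%:~R / 2; (u i2 0)%:~R - (u i1 0)%:~R / 2;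
            (u i3 0)%:~R - (u i1 0)%:~R / 2; (u i1 0)%:~R / 2] i.

Lemma rv_D4_embedding u : rv (F *m u) = \sum_i frame_coord u i *: rv (e i).
Proof.
rewrite D4_embedding_mul !rvD !rvZ !rvB xE !sum4 /frame_coord /=.
by apply/colP => i; rewrite !mxE; lra.
Qed.

Lemma D4_embedding_norm u : q (F *m u) = m / 2 * (d4form u)%:~R.
Proof.
rewrite rv_D4_embedding frame_norm sum4 /frame_coord /= /d4form.
by rewrite !(rmorphD, rmorphXn, rmorphB) /=; field.
Qed.

(** The coordinates a_i are all integral or all half odd, so the sums a_i + a_3 are integers; up to
    order they are the coordinates in the D4 basis. *)
Lemma D4_embedding_span v : in_span R e v -> exists u, v = F *m u.
Proof.
move=> [a vE]; have intE : exists z : 'I_4 -> int, a i3 + a i3 = (z i3)%:~R /\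
    forall i, i != i3 -> a i + a i3 = (z i)%:~R.
  suff /choice[z zE] : forall i, exists z : int, a i + a i3 = z%:~R by exists z.
  move=> i; apply/intrP; have [ha|[_ ha]] := coords_small pdQ (leqnn 4) Me fe vE.
    exact: rpredD.
  have -> : a i + a i3 = (a i - 2^-1) + (a i3 - 2^-1) + 1 by lra.
  exact: (rpredD (rpredD (ha i) (ha i3)) (rpred1 _)).
have [z [z3 zE]] := intE.
exists (\col_(i < 4) nth 0 [:: z i0; z i3; z i1; z i2] i).
apply: (@rv_inj R); rewrite rv_D4_embedding [LHS]vE !sum4 /frame_coord !mxE /=.
by rewrite -z3 -!zE //; do 3?congr (_ + _); congr (_ *: _); lra.
Qed.

Lemma D4_embedding_saturated : saturated F^T.
Proof.
move=> z y w z0 e0; have zR : z%:~R != 0 :> R by rewrite intr_eq0.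
have e1 : z *: y^T = F *m w^T by rewrite -trmxZ e0 trmx_mul trmxK.
have [|u yE] := @D4_embedding_span y^T.
  exists (fun i => (z%:~R)^-1 * frame_coord w^T i).
  apply: (scalemx_inj zR); rewrite /= -[LHS]rvZ e1 rv_D4_embedding scaler_sumr.
  by apply: eq_bigr => i _; rewrite scalerA mulrA mulfV // mul1r.
exists u^T; apply: trmx_inj; rewrite trmxZ trmxK; apply/eqP; rewrite -subr_eq0.
apply/negPn/negP => /d4form_ge2.
have : q (F *m (w^T - z *: u)) = 0.
  rewrite mulmxBr -e1 yE -scalemxAr subrr rv0 /qform mulmx0 mxE //.
rewrite D4_embedding_norm => /eqP; rewrite mulf_eq0 intr_eq0 => /orP[|/eqP-> //].
by rewrite mulf_eq0 invr_eq0 pnatr_eq0 orbF gt_eqF // (q_gt0 pdQ (Min_neq0 (Me i0))).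
Qed.

Definition symprod (t : 'I_#|{: symidx 4}|) : 'M[R]_g :=
  let: (i, j) := sympair t in if i == j then rank1 (rv (e i))
  else rv (e i) *m (rv (e j))^T + rv (e j) *m (rv (e i))^T.

(** A mixed product is the second difference of the forms at the minimal vectors x, x - e_i, x - e_j
    and x - e_i - e_j. *)
Lemma symprod_hull t : symprod t \in linear_hull (sigma Q).
Proof.
rewrite /symprod; case: (sympair t) => i j; case: eqVneq => [_|ij].
  exact: rank1_hull.
have [Mx Mxi Mxij] := half_sum_Min.
pose y := rv x; pose a := rv (e i); pose b := rv (e j).
have -> : rv (e i) *m (rv (e j))^T + rv (e j) *m (rv (e i))^T =
    rank1 y + rank1 (y - a - b) - rank1 (y - a) - rank1 (y - b).
  rewrite -/a -/b /rank1; apply/matrixP => k l; rewrite !mxE !big_ord1 !mxE; ring.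
by rewrite !rpredB ?rpredD // -?rvB rank1_hull //; apply: Mxij.
Qed.

Lemma symprod_indep (c : 'I_#|{: symidx 4}| -> R) :
  \sum_t c t *: symprod t = 0 -> forall t, c t = 0.
Proof.
move=> c0 t; have /row_freeP[B EB] := fe.
have eB i : (rv (e i))^T *m B = delta_mx 0 i.
  rewrite -[delta_mx _ _]mulmx1 -EB mulmxA -rowE -map_row rowK -map_trmx //.
have prodB i j : B^T *m (rv (e i) *m (rv (e j))^T) *m B = delta_mx i j.
  rewrite mulmxA -mulmxA eB -[rv (e i)]trmxK -trmx_mul eB trmx_delta.
  by rewrite mul_delta_mx.
have symB s : (B^T *m symprod s *m B) (sympair t).1 (sympair t).2 = (s == t)%:R.
  rewrite /symprod; have le_s := sympair_le s; have le_t := sympair_le t.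
  rewrite -(inj_eq (@sympair_inj 4)).
  case: (sympair s) le_s => i j; case: (sympair t) le_t => k l /= kl ij'.
  rewrite xpair_eqE; case: eqVneq => [->|ij].
    by rewrite prodB mxE ![_ == j]eq_sym.
  rewrite mulmxDr mulmxDl !prodB !mxE ![_ == i]eq_sym ![_ == j]eq_sym.
  have [/eqP jk|_] := boolP (j == k); last by rewrite /= addr0.
  have [/eqP il|_] := boolP (i == l); last by rewrite andbF addr0.
  by case/eqP: ij; apply/val_inj/anti_leq; rewrite ij' jk il kl.
have := congr1 (fun X => (B^T *m X *m B) (sympair t).1 (sympair t).2) c0.
rewrite mulmx0 mul0mx [RHS]mxE mulmx_sumr mulmx_suml summxE.
rewrite (bigD1 t) //= big1 => [|s st].
  by rewrite -scalemxAr -scalemxAl mxE symB eqxx mulr1 addr0.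
by rewrite -scalemxAr -scalemxAl mxE symB (negPf st) mulr0.
Qed.

Lemma D4_dim_ge : (10 <= cone_dim (sigma Q))%N.
Proof. by rewrite -card_symidx4; apply: dim_ge_indep symprod_hull symprod_indep. Qed.

(** Otherwise there are eleven independent forms: evaluation at a y orthogonal to all [e i] isolates
    the coefficient of [rank1 (rv v)]. *)
Lemma D4_Min_span v : (cone_dim (sigma Q) <= 10)%N -> Min v -> in_span R e v.
Proof.
move=> d10 Mv; apply: contrapT => /separating_vector[y [ye yv]].
pose X (i : 'I_(#|{: symidx 4}|.+1)) : 'M[R]_g :=
  if unlift ord0 i is Some t then symprod t else rank1 (rv v).
have : (#|{: symidx 4}|.+1 <= cone_dim (sigma Q))%N.
  apply: (dim_ge_indep (X := X)) => [i|c].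
    rewrite /X; case: unliftP => [t _|_]; [exact: symprod_hull|exact: rank1_hull].
  rewrite big_ord_recl /X unlift_none => c0.
  have yT u : y^T *m rv u = ((rv u)^T *m y)^T by rewrite trmx_mul trmxK.
  have ye0 i : (rv (e i))^T *m y = 0.
    by rewrite [LHS]mx11_scalar ye ?raddf0 //; apply: in_span_mem.
  have c00 : c ord0 = 0.
    have := congr1 (fun Z => (y^T *m Z *m y) 0 0) c0.
    rewrite mulmx0 mul0mx [RHS]mxE mulmxDr mulmxDl mulmx_sumr mulmx_suml big1 => [|t _].
      rewrite addr0 -scalemxAr -scalemxAl mxE /rank1 mulmxA yT -mulmxA mxE big_ord1 mxE.
      by move/eqP; rewrite !mulf_eq0 !orbb (negPf yv) orbF => /eqP.
    rewrite liftK -scalemxAr -scalemxAl /symprod; case: (sympair t) => i j.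
    case: ifP => _; rewrite /rank1 ?mulmxDr ?mulmxDl !mulmxA !yT !ye0 trmx0 !mul0mx.
      by rewrite scaler0.
    by rewrite addr0 scaler0.
  move: c0; rewrite c00 scale0r add0r => c0 i.
  case: (unliftP ord0 i) => [t ->|-> //].
  apply: (symprod_indep (c := fun t => c (lift ord0 t))); rewrite -[RHS]c0.
  by apply: eq_bigr => s _; rewrite liftK.
by rewrite card_symidx4 => /leq_trans/(_ d10).
Qed.

(** Saturation completes the embedding to a unimodular matrix; in dimension at most 10 no minimal
    vector lies outside the image of D4. *)
Lemma D4_equivalent : (cone_dim (sigma Q) <= 10)%N ->
  (4 <= g)%N /\ GLZ_equivalent (@D4_cone R g) (sigma Q).
Proof.
move=> d10; have [le [P uP FP]] := saturated_completion D4_embedding_saturated.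
split=> //; exists P^T; split; first by rewrite unitmx_tr.
have FE : F = P^T *m pid_mx 4.
  by rewrite -[F]trmxK FP trmx_mul tr_pid_mx.
have m2 : 0 < m / 2 by rewrite divr_gt0 // (q_gt0 pdQ (Min_neq0 (Me i0))).
have MinE := Min_embedding m2 D4_embedding_norm
  (fun v Mv => D4_embedding_span (D4_Min_span d10 Mv)) (Me i0).
rewrite D4_coneE congruence_rank1_cone image_comp.
rewrite -[LHS]/(@rank1_cone R _ Min) MinE; congr rank1_cone; apply: eq_imagel => u _.
by rewrite /= mulmxA FE.
Qed.

End D4Quadruple.

(** * The D4 cone is a perfect cone of dimension at most 10 *)

Section D4Cone.
Variable R : realType.

Local Notation i0 := (ord0 : 'I_4).
Local Notation i1 := (lift ord0 ord0 : 'I_4).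
Local Notation i2 := (lift ord0 (lift ord0 ord0) : 'I_4).
Local Notation i3 := (lift ord0 (lift ord0 (lift ord0 ord0)) : 'I_4).

Lemma d4form_intr (u : 'cV[int]_4) : d4form (realify R u) = (d4form u)%:~R.
Proof. by rewrite /d4form !mxE !(rmorphD, rmorphXn, rmorphN). Qed.

Lemma d4form_ge0 (a : 'cV[R]_4) : 0 <= d4form a.
Proof. by rewrite /d4form !addr_ge0 ?sqr_ge0. Qed.

Lemma d4form_eq0 (a : 'cV[R]_4) : d4form a = 0 -> a = 0.
Proof.
move=> a0; have le0 : d4form a <= 0 by rewrite a0.
have [e1 e2 e3 e4] := sum4_sqr_eq0 le0.
have [z1 z2 z3] : [/\ a i1 0 = 0, a i2 0 = 0 & a i3 0 = 0] by split; lra.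
by apply/colP; apply: ord4P; rewrite [RHS]mxE.
Qed.

(* The last h vectors have norm 3, while the minimum of D4 is 2. *)
Definition D4_gram (h : nat) : 'M[R]_(4 + h) :=
  block_mx ((realify R D4_basis)^T *m realify R D4_basis) 0 0 3%:M.

Lemma qform_D4_gram h (a : 'cV[R]_4) (b : 'cV[R]_h) :
  qform (D4_gram h) (col_mx a b) = d4form a + 3 * \sum_i b i 0 ^+ 2.
Proof.
rewrite /qform /D4_gram tr_col_mx mul_row_block !mulmx0 addr0 add0r mul_row_col mxE.
congr (_ + _); last first.
  rewrite mul_mx_scalar -scalemxAl mxE; congr (_ * _).
  by rewrite mxE; apply: eq_bigr => i _; rewrite mxE expr2.
rewrite mulmxA -trmx_mul -mulmxA mxE sum4.
have E : [/\ (realify R D4_basis *m a) i0 0 = a i0 0,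
    (realify R D4_basis *m a) i1 0 = a i1 0 - a i0 0,
    (realify R D4_basis *m a) i2 0 = a i2 0 + a i3 0 - a i1 0 &
    (realify R D4_basis *m a) i3 0 = a i3 0 - a i2 0].
  by split; rewrite mxE sum4 !mxE /=; ring.
have [E0 E1 E2 E3] := E.
by rewrite ![(_^T) _ _]mxE E0 E1 E2 E3 /d4form !expr2.
Qed.

Lemma qform_D4_gram_int h (v : 'cV[int]_(4 + h)) :
  qform (D4_gram h) (realify R v) =
  (d4form (usubmx v) + 3 * \sum_i dsubmx v i 0 ^+ 2)%:~R.
Proof.
rewrite -[in LHS](vsubmxK v) /realify map_col_mx qform_D4_gram -/(realify R _).
rewrite d4form_intr [RHS]intrD intrM rmorph_sum /=; congr (_ + _ * _).
by apply: eq_bigr => i _; rewrite !mxE rmorphXn.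
Qed.

Lemma D4_gram_pd h : positive_definite (D4_gram h).
Proof.
split=> [|x x0].
  by rewrite /symmetric_mx /D4_gram tr_block_mx !trmx0 trmx_mul trmxK tr_scalar_mx.
rewrite -[x]vsubmxK qform_D4_gram.
have sq : 0 <= \sum_i dsubmx x i 0 ^+ 2 by apply: sumr_ge0 => i _; apply: sqr_ge0.
have d0 := d4form_ge0 (usubmx x).
rewrite lt_neqAle addr_ge0 ?mulr_ge0 // andbT eq_sym.
apply: contraNneq x0 => /eqP; rewrite paddr_eq0 ?mulr_ge0 // => /andP[/eqP/d4form_eq0 u0].
rewrite mulf_eq0 pnatr_eq0 /= => /eqP s0; rewrite -[x]vsubmxK u0.
rewrite (_ : dsubmx x = 0) ?col_mx0 //; apply/colP => i; rewrite [RHS]mxE.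
apply/eqP; rewrite -sqrf_eq0; apply/eqP.
by apply: (psumr_eq0P _ s0) => // j _; apply: sqr_ge0.
Qed.

(** A nonzero lower part alone contributes at least 3. *)
Lemma D4_gram_value h (v : 'cV[int]_(4 + h)) : v != 0 ->
  2 <= d4form (usubmx v) + 3 * \sum_i dsubmx v i 0 ^+ 2 /\
  (d4form (usubmx v) + 3 * \sum_i dsubmx v i 0 ^+ 2 <= 2 -> dsubmx v = 0).
Proof.
move=> v0; have sq (w : 'cV[int]_h) : 0 <= \sum_i w i 0 ^+ 2.
  by apply: sumr_ge0 => i _; apply: sqr_ge0.
have d0 : 0 <= d4form (usubmx v).
  by rewrite /d4form !addr_ge0 ?sqr_ge0.
have [w0|w0] := eqVneq (dsubmx v) 0.
  have u0 : usubmx v != 0.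
    by apply: contraNneq v0 => u0; rewrite -[v]vsubmxK u0 w0 col_mx0.
  split=> //; apply: le_trans (d4form_ge2 u0) _.
  by rewrite lerDl mulr_ge0.
have s1 : 1 <= \sum_i dsubmx v i 0 ^+ 2.
  have s0 := sq (dsubmx v).
  have : \sum_i dsubmx v i 0 ^+ 2 != 0.
    apply: contraNneq w0 => s00; apply/eqP/colP => i; rewrite [RHS]mxE.
    apply/eqP; rewrite -sqrf_eq0; apply/eqP.
    by apply: (psumr_eq0P _ s00) => // j _; apply: sqr_ge0.
  lia.
by split; lia.
Qed.

Lemma D4_cone_perfect h : perfect_cone (@D4_cone R (4 + h)).
Proof.
left; exists (D4_gram h); split; first exact: D4_gram_pd.
pose F : 'M[int]_(4 + h, 4) := pid_mx 4.
have FE (u : 'cV[int]_4) : F *m u = col_mx u 0.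
  by rewrite /F pid_mx_col mul_col_mx mul1mx mul0mx.
have FQ (u : 'cV[int]_4) :
    qform (D4_gram h) (realify R (F *m u)) = 1 * (d4form u)%:~R.
  rewrite qform_D4_gram_int FE col_mxKu col_mxKd big1 ?mulr0 ?addr0 ?mul1r //.
  by move=> i _; rewrite mxE expr0n.
pose v0 : 'cV[int]_(4 + h) := F *m delta_mx i0 0.
have d0 : delta_mx i0 0 != 0 :> 'cV[int]_4.
  by apply/eqP => /colP/(_ i0)/eqP; rewrite !mxE.
have v0_val : d4form (delta_mx i0 0 : 'cV[int]_4) = 2 by rewrite /d4form !mxE.
have M0 : Min (D4_gram h) v0.
  split=> // [|w _ w0].
    apply: contraNneq d0 => e; apply/eqP.
    by have := congr1 (@usubmx _ 4 h 1) e; rewrite /v0 FE col_mxKu raddf0.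
  rewrite FQ v0_val mul1r qform_D4_gram_int ler_int.
  by have [] := D4_gram_value w0.
have MinF v : Min (D4_gram h) v -> exists u, v = F *m u.
  move=> Mv; exists (usubmx v); have := Min_le Mv (Min_neq0 M0).
  rewrite FQ v0_val mul1r qform_D4_gram_int ler_int => /(D4_gram_value (Min_neq0 Mv)).2 d00.
  by rewrite FE -d00 vsubmxK.
by rewrite D4_coneE -[RHS]/(rank1_cone (Min (D4_gram h))) (Min_embedding ltr01 FQ MinF M0).
Qed.

(** All generators are images of symmetric 4 by 4 matrices, a space of dimension 10, under one
    linear map. *)
Lemma D4_cone_dim g : (cone_dim (@D4_cone R g) <= 10)%N.
Proof.
pose E : 'M[R]_(g, 4) := realify R (pid_mx 4).
pose s := [seq E *m rowsym (delta_mx 0 t) *m E^T | t : 'I_#|{: symidx 4}|].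
apply: leq_trans (dim_cone_hull_le (U := <<s>>%VS) _) _; last first.
  apply: leq_trans (dim_span _) _.
  by rewrite size_map size_enum_ord card_symidx4.
move=> _ [u _ <-]; rewrite realify_rank1_mul.
rewrite -[realify R (rank1 u)]symrowK; last by rewrite realify_rank1; apply: rank1_symm.
rewrite [symrow _]row_sum_delta rowsym_sum mulmx_sumr mulmx_suml.
apply: memv_suml => t _; rewrite -scalemxAr -scalemxAl memvZ // memv_span //.
by apply/mapP; exists t; rewrite ?mem_enum.
Qed.

End D4Cone.

(** The coordinate at X of a sum of basis members counts the occurrences of X, and a positive count
    stays nonzero in characteristic 0. *)
Lemma sym_basis_sum (K : numFieldType) g (B s1 s2 : seq 'M[K]_g) : sym_basis B ->
  {subset s1 <= B} -> {subset s2 <= B} ->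
  \sum_(X <- s1) X = \sum_(X <- s2) X -> {subset s1 <= s2}.
Proof.
move=> [symB uB] s1B s2B e X Xs1.
pose c (s : seq 'M[K]_g) : 'rV[K]_(size B) :=
  \row_i \sum_(Y <- s) (index Y B == i)%:R.
have cE s : {subset s <= B} -> \sum_(Y <- s) Y = \sum_(i < size B) c s 0 i *: B`_i.
  move=> sB; under [RHS]eq_bigr do rewrite mxE scaler_suml.
  rewrite exchange_big /=; apply: eq_big_seq => Y /sB YB.
  have YB' : (index Y B < size B)%N by rewrite index_mem.
  rewrite (bigD1 (Ordinal YB')) //= eqxx scale1r nth_index // big1 ?addr0 //.
  by move=> i; rewrite -val_eqE /= eq_sym => /negPf->; rewrite scale0r.
have sym1 : symmetric_mx (\sum_(Y <- s1) Y).
  rewrite /symmetric_mx linear_sum; apply: eq_big_seq => Y /s1B/symB.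
  by [].
have [c0 [_ cu]] := uB _ sym1.
have c12 : c s1 = c s2 by rewrite -(cu _ (cE _ s1B)) -(cu _ (etrans e (cE _ s2B))).
have XB : (index X B < size B)%N by rewrite index_mem s1B.
have := congr1 (fun r : 'rV_(size B) => r 0 (Ordinal XB)) c12; rewrite !mxE /=.
apply: contra_eqT => Xs2; rewrite [X in _ != X]big_seq [X in _ != X]big1 => [|Y Ys2].
  rewrite -natr_sum pnatr_eq0 sum_nat_seq_neq0.
  by apply/hasP; exists X => //; rewrite eqxx.
case: eqP => // iXY; case/negP: Xs2.
by rewrite -(nth_index 0 (s1B _ Xs1)) -iXY nth_index // s2B.
Qed.

(** * The D4 cone is not simplicial *)

Section NotSimplicial.
Variable R : realType.

(* Coordinates of the minimal vectors e1 + e2, e1 - e2, e3 + e4, e3 - e4 and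
   e1 + e3, e1 - e3, e2 + e4, e2 - e4 of D4; both quadruples are orthogonal, so
   that their rank one forms add up to the same matrix. *)
Definition D4_frame1 : seq (seq int) :=
  [:: [:: 1; 2; 1; 1]; [:: 1; 0; 0; 0]; [:: 0; 0; 0; 1]; [:: 0; 0; 1; 0]].
Definition D4_frame2 : seq (seq int) :=
  [:: [:: 1; 1; 1; 1]; [:: 1; 1; 0; 0]; [:: 0; 1; 0; 1]; [:: 0; 1; 1; 0]].

Definition vec4 (s : seq int) : 'cV[int]_4 := \col_i s`_i.

Lemma D4_frames_minimal s : s \in D4_frame1 ++ D4_frame2 ->
  D4_coordinates (vec4 s) /\ exists i, vec4 s i 0 = 1.
Proof.
rewrite /= !inE => H; rewrite D4_coordP.
have ex (i : 'I_4) : vec4 s i 0 = 1 -> vec4 s != 0 /\ exists i, vec4 s i 0 = 1.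
  move=> si; split; last by exists i.
  by apply/eqP => /colP/(_ i); rewrite si mxE.
suff [/= le2 [i /ex[n0 e1]]] : d4form (vec4 s) <= 2 /\ exists i, vec4 s i 0 = 1.
  by [].
by do 7?[case/predU1P: H => [->|H]]; last move/eqP: H => ->; split; do ?[by rewrite /d4form !mxE];
  ((by exists ord0; rewrite mxE) || (by exists (lift ord0 ord0); rewrite mxE)
   || (by exists (lift ord0 (lift ord0 ord0)); rewrite mxE)
   || (by exists (lift ord0 (lift ord0 (lift ord0 ord0))); rewrite mxE)).
Qed.

Lemma D4_frames_sum :
  \sum_(s <- D4_frame1) rank1 (vec4 s) = \sum_(s <- D4_frame2) rank1 (vec4 s).
Proof.
rewrite !big_cons !big_nil; apply/matrixP => i j.
rewrite /rank1 !mxE !big_ord1 !mxE.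
by move: i j; apply: ord4P; apply: ord4P.
Qed.

(** The left inverse L carries a common prime factor back to [rank1 u], which has a diagonal entry
    1. *)
Lemma content1_mul g (W : 'M[int]_(g, 4)) (L : 'M[int]_(4, g))
    (u : 'cV_4) :
  L *m W = 1%:M -> (exists i, u i 0 = 1) -> content1 (rank1 (W *m u)).
Proof.
move=> LW [i ui]; apply/content1P => p pp pX.
pose Y := \matrix_(i, j) (rank1 (W *m u) i j %/ p%:Z)%Z.
have YE : rank1 (W *m u) = p%:Z *: Y.
  apply/matrixP => k l; rewrite [RHS]mxE [Y _ _]mxE mulrC divzK //.
  by rewrite dvdzE.
have uE : rank1 u = p%:Z *: (L *m Y *m L^T).
  rewrite scalemxAl scalemxAr -YE /rank1 trmx_mul !mulmxA LW mul1mx -!mulmxA.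
  by rewrite -trmx_mul LW trmx1 mulmx1.
have e1 : p%:Z * (L *m Y *m L^T) i i = 1.
  have := congr1 (fun Z : 'M_4 => Z i i) uE; rewrite [RHS]mxE => <-.
  by rewrite /rank1 mxE big_ord1 mxE ui mulr1.
have : (p%:Z %| 1)%Z by rewrite -[X in (_ %| X)%Z]e1 dvdz_mulr.
by rewrite dvdz1 absz_nat => /eqP p1; rewrite p1 in pp.
Qed.

(** The forms of both frames are integral generators; inside one basis, equality of the two sums
    would put the first frame into the second. *)
Lemma D4_not_simplicial g (C : set 'M[R]_g) :
  (4 <= g)%N -> GLZ_equivalent (@D4_cone R g) C -> ~ simplicial C.
Proof.
move=> g4 [U [uU CE]] [B [sB genB]].
pose W := U *m pid_mx 4 : 'M[int]_(g, 4).
pose L : 'M[int]_(4, g) := pid_mx 4 *m invmx U.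
have LW : L *m W = 1%:M.
  by rewrite /L /W mulmxA mulmxKV // mul_pid_mx minnn (minn_idPr g4) pid_mx_1.
rewrite D4_coneE congruence_rank1_cone image_comp in CE.
pose gen s : 'M[rat]_g := (rank1 (W *m vec4 s))%:mx rat.
have inB s : s \in D4_frame1 ++ D4_frame2 -> gen s \in B.
  move=> /D4_frames_minimal[su [i si]]; apply: genB; rewrite CE.
  apply: rank1_integral_generator.
  - by exists (vec4 s) => //=; rewrite mulmxA.
  - apply/eqP => Wu0; have : vec4 s = 0 by rewrite -[LHS]mul1mx -LW -mulmxA Wu0 mulmx0.
    by move=> /colP/(_ i); rewrite si mxE.
  - by apply: (content1_mul LW); exists i.
have rW s : rank1 (W *m vec4 s) = W *m rank1 (vec4 s) *m W^T.
  by rewrite /rank1 trmx_mul !mulmxA.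
have sub : {subset map gen D4_frame1 <= map gen D4_frame2}.
  apply: (sym_basis_sum sB).
  - by move=> _ /mapP[s ss ->]; apply: inB; rewrite mem_cat ss.
  - by move=> _ /mapP[s ss ->]; apply: inB; rewrite mem_cat ss orbT.
  - rewrite !big_map /gen; have E t : \sum_(s <- t) (rank1 (W *m vec4 s))%:mx rat =
        (W *m (\sum_(s <- t) rank1 (vec4 s)) *m W^T)%:mx rat.
      rewrite mulmx_sumr mulmx_suml raddf_sum /=.
      by apply: eq_bigr => s _; rewrite rW.
    by rewrite !E D4_frames_sum.
have /sub/mapP[s s2 e] : gen [:: 1; 2; 1; 1] \in map gen D4_frame1 by apply: mem_head.
have {}e : rank1 (vec4 [:: 1; 2; 1; 1]) = rank1 (vec4 s).
  have eW : rank1 (W *m vec4 [:: 1; 2; 1; 1]) = rank1 (W *m vec4 s).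
    apply/matrixP => i j; apply: (@intr_inj rat).
    by have := congr1 (fun Z : 'M_g => Z i j) e; rewrite /gen ![(_%:mx rat) _ _]mxE.
  have rL v : L *m rank1 (W *m v) *m L^T = rank1 v.
    have E : L *m (W *m v) = v by rewrite mulmxA LW mul1mx.
    by rewrite /rank1 [L *m _]mulmxA E -mulmxA -trmx_mul E.
  by rewrite -rL eW rL.
(* The second diagonal entry is 4 for the vector (1, 2, 1, 1) and 1 throughout the second frame. *)
have := congr1 (fun Z : 'M_4 => Z (lift ord0 ord0) (lift ord0 ord0)) e.
rewrite /rank1 !mxE !big_ord1 !mxE /=; move: s2; rewrite !inE.
by do 3?[case/predU1P => [->|]]; last move/eqP->.
Qed.

End NotSimplicial.

Theorem theorem1 (R : realType) (g : nat) (g_ge1 : (1 <= g)%N) :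
  (forall C : set 'M[R]_g,
     perfect_cone C -> (cone_dim C <= 9)%N -> basic C) /\
  (forall C : set 'M[R]_g,
     perfect_cone C -> (cone_dim C <= 10)%N ->
     (simplicial C <-> ~ ((4 <= g)%N /\ GLZ_equivalent (@D4_cone R g) C))) /\
  ((4 <= g)%N ->
     perfect_cone (@D4_cone R g) /\ (cone_dim (@D4_cone R g) <= 10)%N).
Proof.
have D4_ex (Q : 'M[R]_g) : ~ D4_free Q ->
    exists (e : 'I_4 -> 'cV_g) x, [/\ forall i, Min Q (e i), indep R e &
      realify R x = \sum_i 2^-1 *: realify R (e i)].
  move=> nD4; apply: contrapT => no; apply: nD4 => e x Me fe xE.
  by apply: no; exists e, x.
split; last split.
- move=> C [[Q [pdQ ->]]|->] d9; last exact: zero_cone_basic.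
  (* A D4 quadruple forces dimension at least 10, so the bound 9 leaves no exception. *)
  apply: sigma_basic => //; apply: contrapT => /D4_ex[e [x [Me fe xE]]].
  by have := leq_trans (D4_dim_ge pdQ Me fe xE) d9.
- move=> C pC d10; split=> [sC [g4 eqC]|nC]; first exact: D4_not_simplicial sC.
  case: pC nC d10 => [[Q [pdQ ->]]|->] nC d10; last exact: zero_cone_simplicial.
  apply: sigma_simplicial => //; apply: contrapT => /D4_ex[e [x [Me fe xE]]].
  exact/nC/(D4_equivalent pdQ Me fe xE).
- move=> g4; split; last exact: D4_cone_dim.
  by rewrite -(subnKC g4); apply: D4_cone_perfect.
Qed.
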